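(* Let $P$ be a finite pure poset and let $\mathbb{P}_{\Delta(P)}$ be the associated Hibi toric variety (over $\mathbb{C}$). Then any toric crepant $\mathbb{Q}$-factorialization $X_{\widehat{\Sigma}} \to \mathbb{P}_{\Delta(P)}$ is a small resolution; that is, $X_{\widehat{\Sigma}}$ is non-singular and the morphism is small.
   Context: For a finite poset $P=(P,\prec)$, the order polytope is $\Delta(P)=\{(x_u)_{u\in P} \mid 0\le x_u\le x_v\le 1 \text{ for } u\prec v\in P\}\subset \mathbb{R}^P$, a lattice polytope with respect to the lattice $M=\mathbb{Z}^P$. The Hibi toric variety $\mathbb{P}_{\Delta(P)}$ is the projective toric variety associated with $\Delta(P)$, i.e. the toric variety of the normal fan $\Sigma$ of $\Delta(P)$ in $N_{\mathbb{R}}=\mathbb{R}P$, where $N=\mathbb{Z}P$ is the dual lattice of $M$. A finite poset is pure if all its maximal chains have the same length. For $P$ pure, $\mathbb{P}_{\Delta(P)}$ is a Gorenstein Fano variety with at worst terminal singularities. A toric crepant $\mathbb{Q}$-factorialization of $\mathbb{P}_{\Delta(P)}$ is a toric crepant birational morphism $X_{\widehat{\Sigma}}\to\mathbb{P}_{\Delta(P)}$ from a $\mathbb{Q}$-factorial toric variety; in other words, $\widehat{\Sigma}$ is a maximal simplicial refinement of $\Sigma$ giving a crepant morphism, and $X_{\widehat\Sigma}$ is the corresponding toric variety. A birational morphism is small if its exceptional locus has codimension at least two; a small resolution is a small birational morphism from a non-singular variety. *)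

(* Defs.v *)
From HB Require Import structures.
From mathcomp Require Import all_boot all_order all_algebra.
From mathcomp Require Import mathcomp_extra boolp classical_sets functions cardinality reals.
From mathcomp Require Import complex mpoly.

Set Implicit Arguments.
Unset Strict Implicit.
Unset Printing Implicit Defensive.

Import Order.TTheory GRing.Theory Num.Theory.

Local Open Scope classical_set_scope.
Local Open Scope ring_scope.

Definition chain d (P : finPOrderType d) (A : {set P}) : bool :=
  [forall x in A, forall y in A, (x >=< y)%O].

Definition pure d (P : finPOrderType d) : Prop :=
  forall A B : {set P},
    maxset (@chain d P) A -> maxset (@chain d P) B -> #|A| = #|B|.

Definition order_polytope (R : realType) d (P : finPOrderType d) :
    set {ffun P -> R^o} :=
  [set x | (forall u, 0 <= (x u : R) <= 1) /\
           (forall u v, (u < v)%O -> (x u : R) <= (x v : R))].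
Arguments order_polytope R {d} P.

(** The lattices M and N are both [{ffun I -> int}], their real forms are both
    [{ffun I -> R^o}], and the pairing between M and N is [dot]. *)
Definition dot (I : finType) (T : pzRingType) (m v : {ffun I -> T}) : T :=
  \sum_(j : I) m j * v j.

Section Fans.
Variables (R : realType) (I : finType).
Local Notation ZI := {ffun I -> int}.
Local Notation RI := {ffun I -> R^o}.

Definition toR (v : ZI) : RI := [ffun j => (v j)%:~R].

Definition cone (gs : seq ZI) : set RI :=
  [set x | exists2 c : nat -> R, (forall k, 0 <= c k) &
           x = \sum_(k < size gs) c k *: toR gs`_k].

Definition is_face (tau sigma : set RI) : Prop :=
  exists2 m : RI, (forall v, sigma v -> 0 <= (dot m v : R)) &
    tau = [set v | sigma v /\ (dot m v : R) = 0].

Definition pointed (sigma : set RI) : Prop :=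
  forall v, sigma v -> sigma (- v) -> v = 0.

Record is_fan (Sigma : set (set RI)) : Prop := IsFan {
  fan_finite : finite_set Sigma;
  fan_rational : forall sigma, Sigma sigma -> exists gs, sigma = cone gs;
  fan_pointed : forall sigma, Sigma sigma -> pointed sigma;
  fan_face : forall sigma tau, Sigma sigma -> is_face tau sigma -> Sigma tau;
  fan_cap : forall sigma tau, Sigma sigma -> Sigma tau ->
    is_face (sigma `&` tau) sigma /\ is_face (sigma `&` tau) tau }.

(** [normal_cone D x] is the cone of linear forms whose minimum over [D] is
    attained at [x]. It depends only on the face of [D] having [x] in its
    relative interior, so [normal_fan D] has one cone per nonempty face. *)
Definition normal_cone (D : set RI) (x : RI) : set RI :=
  [set v | forall y, D y -> (dot x v : R) <= (dot y v : R)].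

Definition normal_fan (D : set RI) : set (set RI) :=
  [set normal_cone D x | x in D].

Definition support (Sigma : set (set RI)) : set RI :=
  \bigcup_(sigma in Sigma) sigma.

Definition refines (Sigma' Sigma : set (set RI)) : Prop :=
  (forall sigma', Sigma' sigma' ->
     exists2 sigma, Sigma sigma & sigma' `<=` sigma) /\
  support Sigma' = support Sigma.

Definition simplicial (Sigma : set (set RI)) : Prop :=
  forall sigma, Sigma sigma ->
    exists2 gs : seq ZI, free (map toR gs) & sigma = cone gs.

Definition primitive (v : ZI) : Prop :=
  forall (w : ZI) (k : nat), v = w *+ k -> k = 1%N.

Definition ray_generator (Sigma : set (set RI)) (v : ZI) : Prop :=
  primitive v /\ Sigma (cone [:: v]).

(** A torus-invariant Weil divisor sum_v D_v [D_v] on the toric variety of a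
    fan is given by its coefficients on the primitive ray generators. *)
Definition canonical_divisor : ZI -> int := fun=> -1.

(** Let [Sigma'] refine [Sigma]. A torus-invariant Cartier divisor on X_Sigma
    has local equations chi^(- m sigma), sigma in [Sigma], and the order of
    chi^m along the divisor of a ray generator [v] is <m, v>. The proposition
    says that the pullback to X_Sigma' of the Cartier divisor with local data
    [m] is [k] times the Weil divisor [D]. For [Sigma' = Sigma] and [0 < k]
    it says that [k D] is Cartier with local data [m]. *)
Definition pulls_back_to (Sigma' Sigma : set (set RI)) (k : nat)
    (m : set RI -> ZI) (D : ZI -> int) : Prop :=
  forall sigma v, Sigma sigma -> ray_generator Sigma' v -> sigma (toR v) ->
    - dot (m sigma) v = k%:Z * D v.

(** The canonical divisor of X_Sigma is Q-Cartier and its pullback is the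
    canonical divisor of X_Sigma'. *)
Definition crepant (Sigma' Sigma : set (set RI)) : Prop :=
  exists k m, [/\ (0 < k)%N,
    pulls_back_to Sigma Sigma k m canonical_divisor &
    pulls_back_to Sigma' Sigma k m canonical_divisor].

Definition crepant_Qfactorialization (Sigma' Sigma : set (set RI)) : Prop :=
  [/\ is_fan Sigma', refines Sigma' Sigma, simplicial Sigma' &
      crepant Sigma' Sigma].

End Fans.

Section LocalRings.
Variable K : fieldType.
Implicit Types A O p : set K.

Definition prime_ideal A p : Prop :=
  [/\ p `<=` A, p 0 /\ (forall f g, p f -> p g -> p (f + g)),
      (forall a f, A a -> p f -> p (a * f)), ~ p 1 &
      (forall f g, A f -> A g -> p (f * g) -> p f \/ p g)].

Definition localization A p : set K :=
  [set h | exists f g, [/\ A f, A g, ~ p g & h = f / g]].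

(** The nonunits of [O], that is, its maximal ideal if [O] is local. *)
Definition max_ideal O : set K :=
  [set f | O f /\ ~ (f != 0 /\ O f^-1)].

Definition krull_dim_ge O (n : nat) : Prop :=
  exists p : nat -> set K,
    (forall i, (i <= n)%N -> prime_ideal O (p i)) /\
    (forall i, (i < n)%N -> p i `<` p i.+1).

(** The maximal ideal has at most dim [O] generators (a local Noetherian ring
    never has fewer generators than its dimension). *)
Definition regular_local_ring O : Prop :=
  exists n (g : 'I_n -> K),
    [/\ (forall i, max_ideal O (g i)),
        (forall f, max_ideal O f -> exists2 a : 'I_n -> K,
           (forall i, O (a i)) & f = \sum_i a i * g i) &
        krull_dim_ge O n].

(** An integral separated scheme with function field [K] is represented by
    the set of the local rings of all its points inside [K] (a point is
    determined by its local ring, by the valuative criterion). A birational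
    morphism X -> Y inducing the identity on [K] sends the point with local
    ring [O] to the point of Y whose local ring is dominated by [O]. *)
Definition dominates O O' : Prop :=
  O' `<=` O /\ max_ideal O' = max_ideal O `&` O'.

Definition nonsingular (X : set (set K)) : Prop :=
  forall O, X O -> regular_local_ring O.

(** The points of X near which X -> Y is not an isomorphism: as the morphism
    is of finite type, these are the points x mapping to y for which the
    inclusion of the local ring of y in that of x is not an equality. *)
Definition exceptional_locus (X Y : set (set K)) : set (set K) :=
  [set O | X O /\ forall O', Y O' -> dominates O O' -> O' <> O].

(** The codimension of a closed subset is the least dimension of the local
    rings at its points. *)
Definition codim_ge (E : set (set K)) (n : nat) : Prop :=
  forall O, E O -> krull_dim_ge O n.

Definition small_morphism (X Y : set (set K)) : Prop :=
  codim_ge (exceptional_locus X Y) 2.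

End LocalRings.

Section ToricVarieties.
Variables (R : realType) (I : finType).

(** The function field C(M) of the torus, M = Z^I, as the field of rational
    functions in variables indexed by I. *)
Definition function_field : fieldType := {fraction {mpoly R[i][#|I|]}}.

Definition scalar (c : R[i]) : function_field := tofrac (mpolyC #|I| c).

Definition character (m : {ffun I -> int}) : function_field :=
  \prod_(j : I) (tofrac (mpolyX R[i] (mnm1 (enum_rank j))) : function_field) ^ m j.

Definition dual_monoid (sigma : set {ffun I -> R^o}) : set {ffun I -> int} :=
  [set m | forall v, sigma v -> 0 <= (dot (toR R m) v : R)].

(** The monoid algebra of [dual_monoid sigma], inside C(M). *)
Definition chart_ring (sigma : set {ffun I -> R^o}) : set function_field :=
  [set f | exists2 s : seq (R[i] * {ffun I -> int}),
     (forall t, t \in s -> dual_monoid sigma t.2) &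
     f = \sum_(t <- s) scalar t.1 * character t.2].

(** X_Sigma is the union of the affine charts Spec (chart_ring sigma). *)
Definition toric_variety (Sigma : set (set {ffun I -> R^o})) :
    set (set function_field) :=
  [set O | exists sigma p, [/\ Sigma sigma, prime_ideal (chart_ring sigma) p &
     O = localization (chart_ring sigma) p]].

End ToricVarieties.

Definition hibi_fan (R : realType) d (P : finPOrderType d) :
    set (set {ffun P -> R^o}) :=
  normal_fan (order_polytope R P).
Arguments hibi_fan R {d} P.

(* Main.v *)
(** By Farkas' lemma the cones of the normal fan of the order polytope are
    spanned by the vectors [e_b - e_a] of the edges of the Hasse diagram of [P]
    with a bottom and a top adjoined ([e_bottom = e_top = 0]). On each cone
    crepancy gives a linear form equal to a positive constant on these vectors
    and on the ray generators of the refinement, so such a generator is a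
    lattice point in the convex hull of edge vectors, hence an edge vector. Thus
    the refinement adds no rays. As network matrices are totally unimodular, the
    generators of each of its simplicial cones extend to a basis of the lattice,
    and each chart is a product of affine lines and of punctured lines. Its local
    rings are regular by induction on the number of variables, since the ring of
    polynomials over a regular ring is regular. A point lying on two divisors of
    rays has a local ring of dimension at least two, and any other point lies in
    the chart of a ray or of the zero cone, which is also a chart of the Hibi
    variety. *)

Require Import Defs.
From mathcomp Require Import all_boot all_order all_algebra.
From mathcomp Require Import boolp classical_sets reals.
From mathcomp Require Import complex mpoly ring lra zify.

Set Implicit Arguments.
Unset Strict Implicit.
Unset Printing Implicit Defensive.

Import Order.TTheory GRing.Theory Num.Theory.

Local Open Scope classical_set_scope.
Local Open Scope ring_scope.

(** * Regular rings *)

Section PrimeIdeals.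
Variable A : idomainType.
Implicit Types p : set A.

Definition is_prime p : Prop :=
  [/\ p 0, (forall f g, p f -> p g -> p (f + g)), (forall a f, p f -> p (a * f)),
      ~ p 1 & (forall f g, p (f * g) -> p f \/ p g)].

Lemma is_prime_sum p (J : Type) (r : seq J) (Q : pred J) (F : J -> A) :
  is_prime p -> (forall j, Q j -> p (F j)) -> p (\sum_(j <- r | Q j) F j).
Proof. by case=> p0 pD _ _ _ pF; apply: big_ind. Qed.

Lemma is_primeN p f : is_prime p -> p f -> p (- f).
Proof. by case=> _ _ pM _ _ pf; rewrite -mulN1r; apply: pM. Qed.

Lemma is_primeX p f k : is_prime p -> ~ p f -> ~ p (f ^+ k).
Proof.
by case=> _ _ _ p1 pP pf; elim: k => [|k IH]; rewrite ?expr0 // exprS => /pP [].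
Qed.

(** Some [s] outside [p] multiplies [f] into the ideal of [g 0 .. g n.-1]: the
    fraction [f / 1] lies in the ideal they generate in the local ring at [p]. *)
Definition locally_spanned p n (g : nat -> A) f : Prop :=
  exists s (a : nat -> A), ~ p s /\ s * f = \sum_(i < n) a i * g i.

(** Regularity of the local ring at [p], expressed inside [A]: the [g i] generate its maximal ideal,
    and the chain of primes [q] bounds its dimension below by their number. *)
Definition regular_at p : Prop :=
  exists n (g : nat -> A) (q : nat -> set A),
    [/\ forall i, (i < n)%N -> p (g i),
        forall f, p f -> locally_spanned p n g f,
        forall i, (i <= n)%N -> is_prime (q i),
        forall i, (i < n)%N -> q i `<` q i.+1 &
        q n = p].

Definition regular_ring : Prop := forall p, is_prime p -> regular_at p.

Lemma locally_spanned_sum p n g (m : nat) (F : nat -> A) : is_prime p ->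
  (forall j, locally_spanned p n g (F j)) ->
  locally_spanned p n g (\sum_(j < m) F j).
Proof.
move=> pp Fg; elim: m => [|m [s [a [ps sa]]]].
  exists 1, (fun=> 0); split; first by case: pp.
  by rewrite big_ord0 mulr0 big1 // => i _; rewrite mul0r.
have [t [b [pt tb]]] := Fg m.
exists (s * t), (fun i => t * a i + s * b i); split; first by case: pp => _ _ _ _ H /H [].
under [RHS]eq_bigr do rewrite mulrDl -!mulrA.
by rewrite big_split /= -!mulr_sumr -sa -tb big_ord_recr /=; ring.
Qed.

End PrimeIdeals.

Lemma regular_field (F : fieldType) : regular_ring F.
Proof.
move=> p pp; exists 0%N, (fun=> 0), (fun=> p); split=> // f pf.
exists 1, (fun=> 0); split; first by case: pp.
have [->|f0] := eqVneq f 0; first by rewrite mulr0 big_ord0.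
by case: pp => _ _ pM p1 _; case: p1; rewrite -(mulVf f0); apply: pM.
Qed.

Section PolynomialRing.
Variable A : idomainType.
Implicit Types (p q : set A) (P : set {poly A}).

Definition extension q : set {poly A} := [set f | forall i, q f`_i].

(** If [f_i] and [g_j] are the first coefficients outside [q], every other term of the coefficient
    of index [i + j] of the product lies in [q], so [f_i g_j] would lie in [q] as well. *)
Lemma extension_prime q : is_prime q -> is_prime (extension q).
Proof.
move=> qq; have [q0 qD qM q1 qP] := qq; split.
- by move=> i; rewrite coef0.
- by move=> f g qf qg i; rewrite coefD; apply: qD.
- by move=> a f qf i; rewrite coefM; apply: is_prime_sum => // j _; apply: qM.
- by move/(_ 0%N); rewrite coef1.
move=> f g qfg; apply: contrapT => /not_orP [qf qg].
have ex h : ~ extension q h -> exists i, `[< ~ q h`_i >].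
  by move=> /existsNP [i qi]; exists i; apply/asboolP.
case: (ex_minnP (ex _ qf)) => i /asboolP qi mini.
case: (ex_minnP (ex _ qg)) => j /asboolP qj minj.
have lti k : (k < i)%N -> q f`_k.
  by move=> ki; apply: contrapT => /asboolP /mini; rewrite leqNgt ki.
have ltj k : (k < j)%N -> q g`_k.
  by move=> kj; apply: contrapT => /asboolP /minj; rewrite leqNgt kj.
have iS : (i < (i + j).+1)%N by rewrite ltnS leq_addr.
have := qfg (i + j)%N; rewrite coefM (bigD1 (Ordinal iS)) //= addKn => qs.
suff /qP [] : q (f`_i * g`_j) by [].
rewrite -[_ * _](addrK (\sum_(k < (i + j).+1 | k != Ordinal iS) f`_k * g`_(i + j - k))).
apply: (qD) => //; apply: is_primeN => //; apply: is_prime_sum => // k ki.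
have [ki'|ik] := ltnP k i; first by rewrite mulrC; apply: qM; apply: lti.
apply/qM/ltj; move/eqP: ki => ki; have : k <> i :> nat by move=> e; apply/ki/val_inj.
by have := ltn_ord k; lia.
Qed.

(** Each step multiplies by the leading coefficient of [d], so that the leading term of [f] can be
    cancelled without dividing. *)
Lemma pseudo_division (d f : {poly A}) : d != 0 ->
  exists k t r, [/\ lead_coef d ^+ k *: f = t * d + r & (size r < size d)%N].
Proof.
move=> d0; have [m] := ubnP (size f); elim: m f => // m IH f /ltnSE fm.
have [fd|df] := ltnP (size f) (size d).
  by exists 0%N, 0, f; rewrite expr0 scale1r mul0r add0r.
have f0 : f != 0.
  by apply: contraNneq d0 => f0; move: df; rewrite f0 size_poly0 leqn0 size_poly_eq0.
set u := lead_coef f *: 'X^(size f - size d).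
have [|k [t [r [e rd]]]] := IH (lead_coef d *: f - u * d).
  have sf : (0 < size f)%N by rewrite size_poly_gt0.
  apply: leq_trans fm; rewrite -[X in (_ < X)%N](prednK sf) ltnS.
  apply/leq_sizeP => j jf.
  rewrite coefB coefZ /u -scalerAl coefZ coefXnM.
  have sd : (0 < size d)%N by rewrite size_poly_gt0.
  have [->|jne] := eqVneq j (size f).-1.
    rewrite ifF; last by lia.
    rewrite -/(lead_coef f) (_ : _ - _ = (size d).-1)%N; last by lia.
    by rewrite [lead_coef d * _]mulrC subrr.
  have sfj : (size f <= j)%N by lia.
  rewrite nth_default // mulr0 ifF; last by lia.
  by rewrite [d`_ _]nth_default ?mulr0 ?subrr // -{1}(subKn df) leq_sub2r.
exists k.+1, (t + lead_coef d ^+ k *: u), r; split=> //.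
rewrite exprSr -scalerA -[lead_coef d *: f](subrK (u * d)) scalerDr e.
by rewrite mulrDl scalerAl addrAC.
Qed.

(** Let [p] be the trace of the prime [P] on [A]. If [P] is not the extension
    of [p], it is locally generated by this extension and a [d] of least degree
    in the difference: the leading coefficient of [d] is outside [p], so pseudo
    division by [d] is a division in the local ring. *)
Lemma regular_polynomial : regular_ring A -> regular_ring {poly A}.
Proof.
move=> regA P PP; have [P0 PD PM P1 Pmul] := PP.
pose p : set A := [set c | P c%:P].
have pp : is_prime p.
  split=> [|f g|a f||f g]; rewrite /p /= ?polyCD ?polyCM //.
  - exact: PD.
  - exact: PM.
  - exact: Pmul.
have [n [g [q [pg gen qp qlt qn]]]] := regA p pp.
have eqlt i : (i < n)%N -> extension (q i) `<` extension (q i.+1).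
  move=> lin; have [sub nsub] := qlt _ lin; split=> [f qf j|sup]; first exact/sub/qf.
  apply: nsub => c qc; have := sup c%:P; rewrite /extension /= => /(_ _ 0%N).
  rewrite coefC; apply=> j; rewrite coefC; case: ifP => // _.
  by case: (qp _ lin).
have extP : extension p `<=` P.
  move=> f pf; rewrite -(coefK f) poly_def; apply: is_prime_sum => // i _.
  by rewrite -mul_polyC mulrC; apply/PM/pf.
have span f : extension p f -> locally_spanned P n (fun i => (g i)%:P) f.
  move=> pf; rewrite -(coefK f) poly_def.
  apply: (@locally_spanned_sum _ P n _ _ (fun j => f`_j *: 'X^j)) => // j.
  have [s [a [ps sa]]] := gen _ (pf j).
  exists s%:P, (fun i => 'X^j * (a i)%:P); split=> //.
  transitivity ('X^j * (s * f`_j)%:P); first by rewrite polyCM -mul_polyC; ring.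
  by rewrite sa rmorph_sum mulr_sumr; apply: eq_bigr => i _; rewrite /= polyCM mulrA.
have [PE|] := pselect (P `<=` extension p).
  have {}PE : extension p = P by apply/seteqP.
  exists n, (fun i => (g i)%:P), (fun i => extension (q i)); split=> //.
  - by move=> f; rewrite -{1}PE => /span.
  - by move=> i /qp /extension_prime.
  - by rewrite qn.
move=> /existsNP [f0 /not_implyP [Pf0 pf0]].
have ex : exists m, `[< exists f, [/\ P f, ~ extension p f & size f = m] >].
  by exists (size f0); apply/asboolP; exists f0.
case: (ex_minnP ex) => m /asboolP [d [Pd pd sd]] mind.
have min f : P f -> (size f < size d)%N -> extension p f.
  move=> Pf fd; apply: contrapT => pf; move: fd; rewrite ltnNge sd mind //.
  by apply/asboolP; exists f.
have d0 : d != 0 by apply/eqP => d0; apply: pd => i; rewrite d0 coef0.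
have sd0 : (0 < size d)%N by rewrite size_poly_gt0.
(* Otherwise removing the leading term of [d] leaves an element of [P] of smaller size, hence in the
   extension of [p], and [d] would lie there too. *)
have lcd : ~ p (lead_coef d).
  move=> plc; apply: pd.
  have Pl : P (lead_coef d *: 'X^((size d).-1)) by rewrite -mul_polyC mulrC; apply: PM.
  have pe : extension p (d - lead_coef d *: 'X^((size d).-1)).
    apply: min; first by apply: PD => //; apply: is_primeN.
    rewrite -[X in (_ < X)%N](prednK sd0) ltnS; apply/leq_sizeP => j jd.
    rewrite coefB coefZ coefXn.
    have [->|jne] := eqVneq j (size d).-1; first by rewrite mulr1 subrr.
    have dj : (size d <= j)%N by lia.
    by rewrite mulr0 subr0 nth_default.
  move=> i; have [p0 pD pM _ _] := pp.
  rewrite -[d](subrK (lead_coef d *: 'X^((size d).-1))) coefD; apply: pD => //.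
  by rewrite coefZ mulrC; apply: pM.
(* The chain of extensions ends at [extension p]; [P] is added on top of it, strictly larger because
   of [d]. *)
exists n.+1, (fun i => if (i < n)%N then (g i)%:P else d),
  (fun i => if (i <= n)%N then extension (q i) else P); split.
- by move=> i _; case: ifP => // /pg.
- move=> f Pf; have [k [t [r [e rd]]]] := pseudo_division f d0.
  have Pr : P r.
    rewrite -[r](addKr (t * d)) -e; apply: PD; first by apply: is_primeN => //; apply: PM.
    by rewrite -mul_polyC; apply: PM.
  have [s [a [Ps sa]]] := span _ (min _ Pr rd).
  exists (s * (lead_coef d ^+ k)%:P), (fun i => if (i < n)%N then a i else s * t); split.
    by move=> /Pmul [//|]; apply: (is_primeX pp lcd).
  rewrite big_ord_recr /= ltnn; under eq_bigr do rewrite ltn_ord.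
  by rewrite -sa -mulrA mul_polyC e; ring.
- by move=> i _; case: ifP => // /qp /extension_prime.
- move=> i iSn; have [lin|ni] := ltnP i n; first by rewrite ltnW //; apply: eqlt.
  have -> : i = n by lia.
  by rewrite leqnn qn; split=> // /(_ d Pd).
- by rewrite ltnn.
Qed.

End PolynomialRing.

(** * Local rings inside a field *)

Section FractionRing.
Variables (A : idomainType) (K : fieldType) (phi : {rmorphism A -> K}).
Hypothesis phi_inj : injective phi.
Variable p : set A.
Hypothesis p_prime : is_prime p.
Implicit Types q : set A.

(** The extension of [q] to the local ring of [A] at [p], realized inside [K]. *)
Definition frac_ideal q : set K :=
  [set h | exists a b, [/\ q a, ~ p b & h = phi a / phi b]].

Definition frac_ring : set K := frac_ideal setT.

Let p_mul b c : ~ p b -> ~ p c -> ~ p (b * c).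
Proof. by case: p_prime => _ _ _ _ pM pb pc /pM []. Qed.

Lemma denominator_neq0 b : ~ p b -> phi b != 0.
Proof.
move=> pb; rewrite -(rmorph0 phi); apply/eqP => /phi_inj b0.
by apply: pb; rewrite b0; case: p_prime.
Qed.

(** Contracting the extended ideal gives back [q]: clearing denominators puts into [q] a multiple of
    [a] by an element outside [p], hence outside [q]. *)
Lemma frac_ideal_num q a b : is_prime q -> q `<=` p -> ~ p b ->
  frac_ideal q (phi a / phi b) -> q a.
Proof.
move=> [_ _ qM _ qP] qp pb [c [d [qc pd /eqP]]].
have /denominator_neq0 b0 := pb; have /denominator_neq0 d0 := pd.
rewrite eqr_div // -!rmorphM => /eqP /phi_inj e.
have : q (a * d) by rewrite e mulrC; apply: qM.
by case/qP => // /qp.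
Qed.

Lemma frac_ideal_sub q : frac_ideal q `<=` frac_ring.
Proof. by move=> h [a [b [qa pb e]]]; exists a, b. Qed.

Lemma frac_ideal_prime q : is_prime q -> q `<=` p ->
  prime_ideal frac_ring (frac_ideal q).
Proof.
move=> qq qp; have [q0 qD qM q1 qP] := qq; have [_ _ _ p1 _] := p_prime.
split.
- exact: frac_ideal_sub.
- split; first by exists 0, 1; rewrite rmorph0 mul0r.
  move=> _ _ [a [b [qa pb ->]]] [c [d [qc pd ->]]].
  have /denominator_neq0 b0 := pb; have /denominator_neq0 d0 := pd.
  exists (a * d + c * b), (b * d); split; last by rewrite rmorphD !rmorphM addf_div.
    by apply: qD; rewrite mulrC; apply: qM.
  exact: p_mul.
- move=> _ _ [a [b [_ pb ->]]] [c [d [qc pd ->]]].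
  exists (a * c), (b * d); split; [exact: qM|exact: p_mul|].
  by rewrite !rmorphM mulf_div.
- have e1 : 1 = phi 1 / phi 1 by rewrite rmorph1 divr1.
  by rewrite e1 => /(frac_ideal_num qq qp p1).
move=> _ _ [a [b [_ pb ->]]] [c [d [_ pd ->]]].
rewrite mulf_div -!rmorphM => /(frac_ideal_num qq qp (p_mul pb pd)) /qP.
by case=> [qa|qc]; [left; exists a, b|right; exists c, d].
Qed.

Lemma max_ideal_frac : max_ideal frac_ring = frac_ideal p.
Proof.
have [p0 _ _ p1 _] := p_prime.
apply/seteqP; split=> [_ [[a [b [_ pb ->]]] inv]|_ [a [b [pa pb ->]]]].
  exists a, b; split=> //; apply: contrapT => pa; apply: inv; split.
    by rewrite mulf_neq0 ?invr_eq0 ?denominator_neq0.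
  by exists b, a; split; rewrite // invf_div.
split; first by exists a, b.
move=> [h0 [c [d [_ pd e]]]]; apply: p1.
have : frac_ideal p 1; last first.
  have e1 : 1 = phi 1 / phi 1 by rewrite rmorph1 divr1.
  by rewrite e1 => /frac_ideal_num; apply=> //; case: p_prime.
have [_ _ pM _ _] := p_prime.
exists (c * a), (d * b); split; [exact: pM|exact: p_mul|].
by rewrite !rmorphM -mulf_div -e mulVf.
Qed.

Lemma krull_dim_frac (q : nat -> set A) n :
  (forall i, (i <= n)%N -> is_prime (q i)) ->
  (forall i, (i < n)%N -> q i `<` q i.+1) -> q n `<=` p ->
  krull_dim_ge frac_ring n.
Proof.
move=> qq qlt qn; exists (fun i => frac_ideal (q i)).
have qp i : (i <= n)%N -> q i `<=` p.
  move=> lin; have [k e] : exists k, (n = i + k)%N by exists (n - i)%N; rewrite subnKC.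
  elim: k i lin e => [|k IH] i lin e; first by move: qn; rewrite e addn0.
  have [|sub _] := qlt i; first by lia.
  by apply: subset_trans sub _; apply: IH; lia.
split=> [i lin|i lin]; first by apply: frac_ideal_prime; [exact: qq|exact: qp].
have [sub nsub] := qlt i lin; split.
  by move=> _ [a [b [qa pb ->]]]; exists a, b; split=> //; apply: sub.
move=> fsub; apply: nsub => a qa.
have [_ _ _ p1 _] := p_prime.
apply: (@frac_ideal_num _ _ 1) => //; [exact/qq/ltnW|exact/qp/ltnW|].
by apply: fsub; exists a, 1.
Qed.

Lemma regular_frac : regular_at p -> regular_local_ring frac_ring.
Proof.
have [_ _ _ p1 _] := p_prime.
move=> [n [g [q [pg gen qq qlt qn]]]].
exists n, (fun i => phi (g i)); rewrite max_ideal_frac; split.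
- by move=> i; exists (g i), 1; split; [exact: pg|exact: p1|rewrite rmorph1 divr1].
- move=> _ [a [b [pa pb ->]]]; have [s [c [ps e]]] := gen a pa.
  have /denominator_neq0 s0 := ps; have /denominator_neq0 b0 := pb.
  exists (fun i : 'I_n => phi (c i) / phi (s * b)) => [i|].
    by exists (c i), (s * b); split=> //; apply: p_mul.
  rewrite rmorphM; under eq_bigr do rewrite mulrAC.
  rewrite -mulr_suml; under eq_bigr do rewrite -rmorphM.
  by rewrite -rmorph_sum -e rmorphM -mulf_div divff // mul1r.
- by apply: (krull_dim_frac qq qlt); rewrite qn.
Qed.

End FractionRing.

Definition mul_closed_ring (K : fieldType) (B : set K) : Prop :=
  [/\ B 1, (forall f g, B f -> B g -> B (f + g)) & (forall f g, B f -> B g -> B (f * g))].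

Lemma prime_ideal_preimage (A : idomainType) (K : fieldType)
    (phi : {rmorphism A -> K}) (B P : set K) :
  range phi `<=` B -> prime_ideal B P -> is_prime (phi @^-1` P).
Proof.
move=> sub [PB [P0 PD] PM P1 Pmul].
have Bphi a : B (phi a) by apply: sub; exists a.
split; rewrite /preimage /= ?rmorph0 ?rmorph1 // => f g; rewrite ?rmorphD ?rmorphM.
- exact: PD.
- exact: PM.
- exact: Pmul.
Qed.

(** The ring [B] lies between the image of [A] and its local ring at the trace of [P], so localizing
    either ring gives the same result. *)
Lemma localization_frac_ring (A : idomainType) (K : fieldType)
    (phi : {rmorphism A -> K}) (B P : set K) :
  injective phi -> mul_closed_ring B -> range phi `<=` B -> prime_ideal B P ->
  B `<=` frac_ring phi (phi @^-1` P) ->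
  localization B P = frac_ring phi (phi @^-1` P).
Proof.
move=> phi_inj [_ _ BM] sub PP Bfrac.
have pp := prime_ideal_preimage sub PP.
have [PB [P0 PD] PM P1 Pmul] := PP.
have Bphi a : B (phi a) by apply: sub; exists a.
have neq0 b : ~ P (phi b) -> phi b != 0 by move/(denominator_neq0 phi_inj pp).
apply/seteqP; split=> [_ [f [g [Bf Bg Pg ->]]]|_ [a [b [_ pb ->]]]]; last first.
  by exists (phi a), (phi b).
have [a [b [_ pb ef]]] := Bfrac f Bf; have [c [d [_ pd eg]]] := Bfrac g Bg.
have b0 := neq0 _ pb; have d0 := neq0 _ pd.
exists (a * d), (b * c); split=> //; last first.
  by rewrite ef eg invf_div mulf_div -!rmorphM.
rewrite /preimage /= rmorphM => /Pmul [//|//|//|].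
have -> : phi c = phi d * g by rewrite eg mulrCA divff // mulr1.
by case/(Pmul _ _ (Bphi d) Bg).
Qed.

(** Whatever [B'] adds to [B] is already in the local ring at [P], so the point survives in [B'].
    Its prime there is the trace of the maximal ideal of that local ring. *)
Lemma localization_overring (K : fieldType) (B B' P : set K) :
  mul_closed_ring B -> mul_closed_ring B' -> prime_ideal B P ->
  B `<=` B' -> B' `<=` localization B P ->
  exists2 P', prime_ideal B' P' & localization B' P' = localization B P.
Proof.
move=> [B1 BD BM] [_ BD' BM'] [PB [P0 PD] PM P1 Pmul] BB' B'O.
have neq0 g : ~ P g -> g != 0 by move=> Pg; apply/eqP => g0; apply: Pg; rewrite g0.
have notP f g : B f -> B g -> ~ P f -> ~ P g -> ~ P (f * g).
  by move=> Bf Bg Pf Pg /(Pmul _ _ Bf Bg) [].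
exists [set h | B' h /\ exists f g, [/\ P f, B g, ~ P g & h = f / g]].
  split.
  - by move=> h [].
  - split; first by split; [exact/BB'/PB|exists 0, 1; rewrite mul0r].
    move=> h h' [Bh [f [g [Pf Bg Pg e]]]] [Bh' [f' [g' [Pf' Bg' Pg' e']]]].
    split; first exact: BD'.
    rewrite e e'.
    exists (f * g' + f' * g), (g * g'); split; [|exact: BM|exact: notP|].
      by apply: PD; rewrite mulrC; apply: PM.
    by rewrite addf_div ?neq0.
  - move=> a f Ba [Bf [c [d [Pc Bd Pd e]]]]; split; first exact: BM'.
    have [c' [d' [Bc' Bd' Pd' e']]] := B'O _ Ba.
    exists (c' * c), (d' * d); split; [exact: PM|exact: BM|exact: notP|].
    by rewrite e e' mulf_div.
  - move=> [_ [f [g [Pf Bg Pg e]]]]; apply: (Pg).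
    by rewrite -[g]mul1r e divfK ?neq0.
  move=> f g Bf Bg [_ [c [d [Pc Bd Pd e]]]].
  have [a [b [Ba Bb Pb ef]]] := B'O _ Bf; have [a' [b' [Ba' Bb' Pb' eg]]] := B'O _ Bg.
  have : P (d * (a * a')).
    have -> : d * (a * a') = (b * b') * c; last by apply: PM => //; apply: BM.
    have /neq0 b0 := Pb; have /neq0 b0' := Pb'; have /neq0 d0 := Pd.
    move: e; rewrite ef eg mulf_div => /eqP; rewrite eqr_div ?mulf_neq0 // => /eqP e.
    by rewrite mulrC e mulrC.
  case/(Pmul _ _ Bd (BM _ _ Ba Ba')) => // /(Pmul _ _ Ba Ba') [Pa|Pa'].
    by left; split=> //; exists a, b.
  by right; split=> //; exists a', b'.
apply/seteqP; split=> [_ [f [g [Bf Bg Pg ->]]]|_ [f [g [Bf Bg Pg ->]]]].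
  have [a [b [Ba Bb Pb ef]]] := B'O _ Bf; have [a' [b' [Ba' Bb' Pb' eg]]] := B'O _ Bg.
  exists (a * b'), (b * a'); split; [exact: BM|exact: BM| |].
    by apply: notP => // Pa'; apply: Pg; split=> //; exists a', b'.
  by rewrite ef eg invf_div mulf_div.
exists f, g; split; [exact: BB'|exact: BB'| |by []].
move=> [_ [c [d [Pc Bd Pd e]]]].
suff /(Pmul _ _ Bg Bd) [] : P (g * d) by [].
by rewrite e divfK ?neq0.
Qed.

(** * Laurent polynomials *)

Section Characters.
Variables (R : realType) (I : finType).
Local Notation ZI := {ffun I -> int}.
Local Notation K := (function_field R I).
Local Notation chi := (@character R I).
Local Notation scal := (@Defs.scalar R I).

Lemma character0 : chi 0 = 1.
Proof. by rewrite /character big1 // => j _; rewrite ffunE expr0z. Qed.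

Lemma variable_neq0 i : (tofrac (mpolyX R[i] (mnm1 i)) : K) != 0.
Proof.
rewrite tofrac_eq0; apply/eqP => /(congr1 (mcoeff (mnm1 i)))/eqP.
by rewrite mcoeffX eqxx mcoeff0 oner_eq0.
Qed.

Lemma characterD m m' : chi (m + m') = chi m * chi m'.
Proof.
rewrite /character -big_split /=; apply: eq_bigr => j _.
by rewrite ffunE expfzDr // variable_neq0.
Qed.

Lemma character_neq0 m : chi m != 0.
Proof. by apply/prodf_neq0 => j _; rewrite expfz_neq0 // variable_neq0. Qed.

Lemma characterX m k : chi (m *+ k) = chi m ^+ k.
Proof.
by elim: k => [|k IH]; rewrite ?mulr0n ?expr0 ?character0 // mulrS exprS characterD IH.
Qed.

Definition constants : {rmorphism R[i] -> K} :=
  (@tofrac {mpoly R[i][#|I|]}) \o (@mpolyC #|I| R[i]).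
Lemma scalarE c : scal c = constants c. Proof. by []. Qed.

Definition exponent (m : ZI) : 'X_{1..#|I|} := [multinom `|m (enum_val i)|%N | i < #|I|].

Lemma character_monomial (m : ZI) : (forall j, 0 <= m j) ->
  chi m = tofrac (mpolyX R[i] (exponent m)).
Proof.
move=> m0; rewrite mpolyXE_id rmorph_prod /character.
rewrite (reindex_onto (fun i => enum_val i) enum_rank) => [|j _]; last exact: enum_rankK.
apply: eq_big => [i|i _]; first by rewrite enum_valK eqxx.
by rewrite enum_valK rmorphXn mnmE exprnP gez0_abs.
Qed.

Lemma exponent_inj (m m' : ZI) : (forall j, 0 <= m j) -> (forall j, 0 <= m' j) ->
  exponent m = exponent m' -> m = m'.
Proof.
move=> m0 m0' /mnmP e; apply/ffunP => j; have := e (enum_rank j).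
by rewrite !mnmE enum_rankK => e'; rewrite -[m j]gez0_abs // -[m' j]gez0_abs // e'.
Qed.

Definition laurent (s : seq (R[i] * ZI)) : K := \sum_(t <- s) scal t.1 * chi t.2.

(** Linear independence of characters: after multiplication by a character that clears negative
    exponents, coefficients can be read in the polynomial ring. *)
Lemma laurent_eq0 (s : seq (R[i] * ZI)) (m : ZI) :
  laurent s = 0 -> \sum_(t <- s | t.2 == m) t.1 = 0.
Proof.
(* [N] bounds all exponents of the terms and of [m] itself, so shifting every coordinate by [N]
   makes them nonnegative. *)
move=> s0; pose N := (\sum_(t <- (0%R, m) :: s) \sum_j `|t.2 j|)%N.
pose shift : ZI := [ffun=> N%:Z].
have pos t : t \in (0, m) :: s -> forall j, 0 <= (t.2 + shift) j.
  move=> ts j; rewrite !ffunE.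
  have : (`|t.2 j| <= N)%N.
    rewrite /N (big_rem t) //= (bigD1 j) //= -addnA; exact: leq_addr.
  have H (a : int) (b : nat) : (`|a| <= b)%N -> 0 <= a + b%:Z by lia.
  exact: H.
have : \sum_(t <- s) t.1 *: mpolyX R[i] (exponent (t.2 + shift)) = 0.
  apply/eqP; rewrite -tofrac_eq0 raddf_sum /=; apply/eqP.
  transitivity (laurent s * chi shift); last by rewrite s0 mul0r.
  rewrite /laurent mulr_suml big_seq [RHS]big_seq; apply: eq_bigr => t ts.
  rewrite -mulrA -characterD character_monomial; last first.
    by apply: pos; rewrite inE ts orbT.
  by rewrite -mul_mpolyC rmorphM.
move/(congr1 (mcoeff (exponent (m + shift)))); rewrite mcoeff0 raddf_sum /= => e.
rewrite -[RHS]e big_mkcond big_seq [RHS]big_seq; apply: eq_bigr => t ts.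
rewrite mcoeffZ mcoeffX.
have -> : (exponent (t.2 + shift) == exponent (m + shift)) = (t.2 == m).
  apply/eqP/eqP => [|->//] /exponent_inj h; apply: (addIr shift); apply: h.
    by apply: pos; rewrite inE ts orbT.
  by apply: (pos (0, m)); rewrite mem_head.
by case: ifP; rewrite ?mulr1 ?mulr0.
Qed.

(** Exponents may repeat in [s], so the terms are regrouped by exponent; the coefficients of each
    exponent then sum to zero. *)
Lemma laurent_graded (T : eqType) (w : ZI -> T) (s : seq (R[i] * ZI)) k :
  laurent s = 0 -> \sum_(t <- s | w t.2 == k) scal t.1 * chi t.2 = 0.
Proof.
move=> s0; pose ms := undup [seq t.2 | t <- s].
transitivity (\sum_(t <- s | w t.2 == k) \sum_(m <- ms | t.2 == m) scal t.1 * chi m).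
  rewrite big_seq_cond [RHS]big_seq_cond; apply: eq_bigr => t /andP [ts _].
  have tm : t.2 \in ms by rewrite mem_undup; apply: map_f.
  rewrite big_mkcond (bigD1_seq t.2) ?undup_uniq //= eqxx big1 ?addr0 // => m.
  by rewrite eq_sym => /negbTE ->.
rewrite (exchange_big_dep (fun m => w m == k)) /=; last by move=> t m /eqP <- /eqP ->.
apply: big1 => m /eqP wm.
rewrite (eq_bigl (fun t => t.2 == m)) => [|t]; last first.
  by apply: andb_idl => /eqP ->; rewrite wm.
by rewrite -mulr_suml -(rmorph_sum constants) laurent_eq0 // rmorph0 mul0r.
Qed.

Definition monoid_algebra (S : set ZI) : set K :=
  [set f | exists2 s : seq (R[i] * ZI), (forall t, t \in s -> S t.2) & f = laurent s].

Lemma laurent_cat s s' : laurent (s ++ s') = laurent s + laurent s'.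
Proof. by rewrite /laurent big_cat. Qed.

Lemma monoid_algebra0 S : monoid_algebra S 0.
Proof. by exists [::]; rewrite // /laurent big_nil. Qed.

Lemma monoid_algebraD S f g :
  monoid_algebra S f -> monoid_algebra S g -> monoid_algebra S (f + g).
Proof.
move=> [s Ss ->] [s' Ss' ->]; exists (s ++ s'); last by rewrite laurent_cat.
by move=> t; rewrite mem_cat => /orP [/Ss|/Ss'].
Qed.

Lemma monoid_algebra_sum S (J : Type) (r : seq J) (F : J -> K) :
  (forall j, monoid_algebra S (F j)) -> monoid_algebra S (\sum_(j <- r) F j).
Proof.
by move=> SF; apply: big_ind => [||j _]; [exact: monoid_algebra0|exact: monoid_algebraD|exact: SF].
Qed.

Lemma monoid_algebra_term (S : set ZI) c m : S m -> monoid_algebra S (scal c * chi m).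
Proof.
move=> Sm; exists [:: (c, m)]; last by rewrite /laurent big_seq1.
by move=> t; rewrite inE => /eqP ->.
Qed.

Lemma monoid_algebraM (S S' S'' : set ZI) f g :
  (forall m m', S m -> S' m' -> S'' (m + m')) ->
  monoid_algebra S f -> monoid_algebra S' g -> monoid_algebra S'' (f * g).
Proof.
move=> SD [s Ss ->] [s' Ss' ->]; rewrite /laurent mulr_suml big_seq.
apply: big_ind => [||t ts]; [exact: monoid_algebra0|exact: monoid_algebraD|].
rewrite mulr_sumr big_seq.
apply: big_ind => [||t' ts']; [exact: monoid_algebra0|exact: monoid_algebraD|].
have -> : scal t.1 * chi t.2 * (scal t'.1 * chi t'.2) = scal (t.1 * t'.1) * chi (t.2 + t'.2).
  by rewrite characterD !scalarE rmorphM; ring.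
by apply/monoid_algebra_term/SD; [apply: Ss|apply: Ss'].
Qed.

Lemma character_algebra (S : set ZI) m : S m -> monoid_algebra S (chi m).
Proof.
move=> Sm; rewrite -[chi m]mul1r -(rmorph1 constants) -scalarE.
exact: monoid_algebra_term.
Qed.

Lemma monoid_algebra_ring (S : set ZI) :
  S 0 -> (forall m m', S m -> S m' -> S (m + m')) -> mul_closed_ring (monoid_algebra S).
Proof.
move=> S0 SD; split; [|exact: monoid_algebraD|].
  by rewrite -character0; apply: character_algebra.
by move=> f g; apply: monoid_algebraM.
Qed.

Lemma monoid_algebra_subset (S : set ZI) (B : set K) : mul_closed_ring B ->
  (forall c, B (scal c)) -> (forall m, S m -> B (chi m)) -> monoid_algebra S `<=` B.
Proof.
move=> [B1 BD BM] Bs BS _ [s Ss ->]; rewrite /laurent big_seq.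
apply: big_ind => // [|t ts]; first by rewrite -(rmorph0 constants) -scalarE.
by apply: BM => //; apply/BS/Ss.
Qed.

Lemma homogeneous_sum_eq0 (w : ZI -> int) n (F : nat -> K) :
  (forall i, monoid_algebra [set m | w m = i%:Z] (F i)) ->
  \sum_(i < n) F i = 0 -> forall i, (i < n)%N -> F i = 0.
Proof.
move=> wF e i lin.
have /choice [s sP] j : exists s, (forall t, t \in s -> w t.2 = j%:Z) /\ F j = laurent s.
  by case: (wF j) => s ws Fs; exists s.
have Fs j : F j = laurent (s j) by case: (sP j).
pose u := flatten [seq s j | j <- iota 0 n].
have u0 : laurent u = 0.
  rewrite /laurent /u big_flatten /= big_map -{1}[n]subn0 -[iota _ _]/(index_iota 0 n).
  by rewrite big_mkord -[RHS]e; apply: eq_bigr => j _; rewrite Fs.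
have := laurent_graded w i%:Z u0.
rewrite /u big_flatten /= big_map -{1}[n]subn0 -[iota _ _]/(index_iota 0 n) big_mkord.
rewrite (bigD1 (Ordinal lin)) //= [X in _ + X]big1 ?addr0 => [|j ji].
  move=> <-; rewrite Fs /laurent big_seq [RHS]big_seq_cond.
  apply: eq_bigl => t; case: (boolP (t \in s i)) => // ts.
  by case: (sP i) => /(_ t ts) /= ->; rewrite eqxx.
rewrite big_seq_cond big1 // => t /andP [ts /eqP wt]; move/eqP: ji; case.
by apply/val_inj => /=; case: (sP j) => /(_ t ts) /=; rewrite wt => -[].
Qed.

End Characters.

(** * Charts of smooth cones *)

Section Dot.
Variables (I : finType) (T : comPzRingType).
Implicit Types m v : {ffun I -> T}.

Lemma dotC m v : dot m v = dot v m.
Proof. by apply: eq_bigr => j _; rewrite mulrC. Qed.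

Lemma dotDl m m' v : dot (m + m') v = dot m v + dot m' v.
Proof. by rewrite /dot -big_split; apply: eq_bigr => j _; rewrite ffunE mulrDl. Qed.

Lemma dot0l v : dot 0 v = 0.
Proof. by apply: big1 => j _; rewrite ffunE mul0r. Qed.

Lemma dotNl m v : dot (- m) v = - dot m v.
Proof. by rewrite /dot -sumrN; apply: eq_bigr => j _; rewrite ffunE mulNr. Qed.

Lemma dotBl m m' v : dot (m - m') v = dot m v - dot m' v.
Proof. by rewrite dotDl dotNl. Qed.

Lemma dotMnl m v k : dot (m *+ k) v = dot m v *+ k.
Proof. by elim: k => [|k IH]; rewrite ?mulr0n ?dot0l // !mulrS dotDl IH. Qed.

Lemma dot_suml (J : Type) (r : seq J) (Q : pred J) (F : J -> {ffun I -> T}) v :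
  dot (\sum_(j <- r | Q j) F j) v = \sum_(j <- r | Q j) dot (F j) v.
Proof. exact: (big_morph (fun m => dot m v) (fun m m' => dotDl m m' v) (dot0l v)). Qed.

End Dot.

Section Models.
Variables (R : realType) (I : finType).
Local Notation ZI := {ffun I -> int}.
Local Notation K := (function_field R I).
Local Notation chi := (@character R I).
Local Notation scal := (@Defs.scalar R I).

(** Grading by the pairing with [w] puts the image of [phi] in degree 0 and [chi m0] in degree 1, so
    [chi m0] is transcendental over this image. Adjoining [m0] to the monoid thus amounts to
    adjoining a polynomial variable. *)
Lemma adjoin_character (A : idomainType) (phi : {rmorphism A -> K})
    (S : set ZI) (w m0 : ZI) :
  dot m0 w = 1 -> S 0 -> (forall x, S x -> dot x w = 0) ->
  injective phi -> range phi = monoid_algebra (R := R) S ->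
  exists psi : {rmorphism {poly A} -> K},
    [/\ injective psi,
        range psi = monoid_algebra (R := R) [set x | exists k : nat, S (x - m0 *+ k)],
        psi 'X = chi m0 & forall c, psi c%:P = phi c].
Proof.
move=> m0w S0 Sw phi_inj phiS.
pose cfu : commr_rmorph phi (chi m0) := fun=> mulrC _ _.
have psiE f : horner_morph cfu f = \sum_(i < size f) phi f`_i * chi (m0 *+ i).
  rewrite /horner_morph horner_coef size_map_inj_poly ?rmorph0 //.
  by apply: eq_bigr => i _; rewrite coef_map_id0 ?rmorph0 // characterX.
have phiA a : monoid_algebra (R := R) S (phi a) by rewrite -phiS; exists a.
exists (horner_morph cfu); split; last exact: horner_morphC.
- apply: raddf_inj => f f0; have {}f0 : horner_morph cfu f = 0 := f0.
  move: f0; rewrite psiE => f0; apply/polyP => i; rewrite coef0.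
  have [si|si] := ltnP i (size f); last by rewrite nth_default.
  apply: phi_inj; rewrite rmorph0; apply/eqP.
  rewrite -[_ == 0]orbF -(negbTE (character_neq0 R (m0 *+ i))) -mulf_eq0; apply/eqP.
  apply: (homogeneous_sum_eq0 (w := fun x => dot x w) (n := size f)
    (F := fun i => phi f`_i * chi (m0 *+ i))) => // k.
  apply: (@monoid_algebraM _ _ S [set m0 *+ k]) => //; last exact: character_algebra.
  by move=> x _ Sx ->; rewrite /= dotDl Sw // dotMnl m0w add0r natz.
- apply/seteqP; split=> [_ [f _ <-]|].
    rewrite [X in monoid_algebra _ X]psiE; apply: monoid_algebra_sum => i.
    apply: (@monoid_algebraM _ _ S [set m0 *+ i]) => //; last exact: character_algebra.
    by move=> x _ Sx ->; exists i; rewrite addrK.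
  apply: monoid_algebra_subset.
  + split; first by exists 1; rewrite ?rmorph1.
      by move=> _ _ [f _ <-] [g _ <-]; exists (f + g); rewrite ?rmorphD.
    by move=> _ _ [f _ <-] [g _ <-]; exists (f * g); rewrite ?rmorphM.
  + move=> c; have [a _ ea] : range phi (scal c).
      rewrite phiS -[scal c]mulr1 -(character0 R I); exact: monoid_algebra_term.
    by exists a%:P => //=; rewrite horner_morphC.
  + move=> x [k Sx].
    have [a _ ea] : range phi (chi (x - m0 *+ k)).
      by rewrite phiS; apply: character_algebra.
    exists (a%:P * 'X^k) => //.
    by rewrite rmorphM rmorphXn /= horner_morphC horner_morphX ea -characterX -characterD subrK.
exact: horner_morphX.
Qed.


Lemma frac_ringE (A : idomainType) (F : fieldType) (phi : {rmorphism A -> F}) (P : set F) :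
  frac_ring phi (phi @^-1` P) = localization (range phi) P.
Proof.
apply/seteqP; split=> [_ [a [b [_ pb ->]]]|_ [_ [_ [[a _ <-] [b _ <-] pb ->]]]].
  by exists (phi a), (phi b).
by exists a, b.
Qed.

Lemma localization_mul_closed (F : fieldType) (B C P : set F) :
  mul_closed_ring C -> C `<=` B -> prime_ideal B P -> mul_closed_ring (localization C P).
Proof.
move=> [C1 CD CM] CB [PB [P0 PD] PM P1 Pmul].
have neq0 g : ~ P g -> g != 0 by move=> Pg; apply/eqP => g0; apply: Pg; rewrite g0.
have notP f g : C f -> C g -> ~ P f -> ~ P g -> ~ P (f * g).
  by move=> /CB Bf /CB Bg Pf Pg /(Pmul _ _ Bf Bg) [].
split; first by exists 1, 1; rewrite divr1.
- move=> _ _ [a [b [Ca Cb Pb ->]]] [c [d [Cc Cd Pd ->]]].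
  exists (a * d + c * b), (b * d); split; [|exact: CM|exact: notP|].
    by apply: CD; apply: CM.
  by rewrite addf_div ?neq0.
move=> _ _ [a [b [Ca Cb Pb ->]]] [c [d [Cc Cd Pd ->]]].
by exists (a * c), (b * d); rewrite mulf_div; split; [exact: CM|exact: CM|exact: notP|].
Qed.

(** A power of [chi s], invertible at [P], brings each character of [S'] into the algebra of [S]. *)
Lemma monoid_algebra_localized (S S' : set ZI) (B P : set K) (s : ZI) :
  mul_closed_ring (monoid_algebra (R := R) S) -> S 0 ->
  monoid_algebra (R := R) S `<=` B -> prime_ideal B P ->
  S s -> ~ P (chi s) -> (forall x, S' x -> exists N : nat, S (x + s *+ N)) ->
  monoid_algebra (R := R) S' `<=` localization (monoid_algebra (R := R) S) P.
Proof.
move=> Sring S0 SB PP Ss Ps S'S; have [S1 SD SM] := Sring.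
have [PB [P0 PD] PM P1 Pmul] := PP.
have SX N : monoid_algebra (R := R) S (chi s ^+ N) /\ ~ P (chi s ^+ N).
  elim: N => [|N [IH1 IH2]]; rewrite ?expr0 // exprS.
  have Cs := character_algebra R Ss.
  by split=> [|/(Pmul _ _ (SB _ Cs) (SB _ IH1)) []//]; apply: SM.
apply: monoid_algebra_subset; first exact: localization_mul_closed SB PP.
- move=> c; exists (scal c), 1; split=> //; last by rewrite divr1.
  by rewrite -[scal c]mulr1 -(character0 R I); apply: monoid_algebra_term.
move=> x /S'S [N SxN]; exists (chi (x + s *+ N)), (chi s ^+ N).
have [? ?] := SX N; split=> //; first exact: character_algebra.
by rewrite characterD characterX mulfK // -characterX character_neq0.
Qed.

Section DualBases.
Variables (J : finType) (v m : J -> ZI).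
Hypothesis dual_vm : forall i j, dot (m i) (v j) = (i == j)%:R.
Hypothesis v_spans : forall x : ZI, (forall j, dot x (v j) = 0) -> x = 0.

(** The free monoid on the [m j] with [j] in [l]. It is indexed by a list so that the variables of
    its algebra can be adjoined one at a time. *)
Definition orthant (l : seq J) : set ZI :=
  [set x | forall j, if j \in l then 0 <= dot x (v j) else dot x (v j) == 0].

(** The exponents of the chart of the cone on the [v j] with [a j]; the characters of the other
    [m j] are units of this chart. *)
Definition dual_orthant (a : pred J) : set ZI :=
  [set x | forall j, a j -> 0 <= dot x (v j)].

Lemma orthant0 l : orthant l 0.
Proof. by move=> j; rewrite dot0l; case: ifP. Qed.

Lemma orthantD l x y : orthant l x -> orthant l y -> orthant l (x + y).
Proof.
move=> lx ly j; move: (lx j) (ly j); rewrite dotDl.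
by case: ifP => _; [apply: addr_ge0|move=> /eqP -> /eqP ->; rewrite addr0].
Qed.

Lemma orthant_ring l : mul_closed_ring (monoid_algebra (R := R) (orthant l)).
Proof. by apply: monoid_algebra_ring; [exact: orthant0|exact: orthantD]. Qed.

Lemma dual_orthant_ring a : mul_closed_ring (monoid_algebra (R := R) (dual_orthant a)).
Proof.
apply: monoid_algebra_ring => [j _|x y ax ay j aj]; first by rewrite dot0l.
by rewrite dotDl addr_ge0 ?ax ?ay.
Qed.

Lemma orthant_cons j l : j \notin l ->
  orthant (j :: l) = [set x | exists k : nat, orthant l (x - m j *+ k)].
Proof.
move=> jl; apply/seteqP; split=> x /=.
  move=> ox; have := ox j; rewrite mem_head => xj; exists `|dot x (v j)|%N => i.
  have := ox i; rewrite inE dotBl dotMnl dual_vm [j == i]eq_sym.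
  have [->|ij] := eqVneq i j; last by rewrite mul0rn subr0.
  by rewrite (negbTE jl) mulr1n natz gez0_abs // subrr.
move=> [k ox] i; have := ox i; rewrite inE dotBl dotMnl dual_vm [j == i]eq_sym.
have [->|ij] := eqVneq i j; last by rewrite mul0rn subr0.
by rewrite (negbTE jl) subr_eq0 => /eqP ->; rewrite ler0n.
Qed.

(** The base case is the field of constants, as [v_spans] leaves only the exponent zero; each
    element of [l] then adds a polynomial variable, which preserves regularity. *)
Lemma orthant_model l : uniq l ->
  exists (A : idomainType) (phi : {rmorphism A -> K}),
    [/\ regular_ring A, injective phi & range phi = monoid_algebra (R := R) (orthant l)].
Proof.
elim: l => [_|j l IH /= /andP [jl ul]].
  exists R[i], (constants R I); split; [exact: regular_field|exact: fmorph_inj|].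
  apply/seteqP; split=> [_ [c _ <-]|].
    rewrite -scalarE -[Defs.scalar _ _]mulr1 -(character0 R I).
    by apply: monoid_algebra_term; apply: orthant0.
  apply: monoid_algebra_subset.
  - split; first by exists 1; rewrite ?rmorph1.
      by move=> _ _ [f _ <-] [g _ <-]; exists (f + g); rewrite ?rmorphD.
    by move=> _ _ [f _ <-] [g _ <-]; exists (f * g); rewrite ?rmorphM.
  - by move=> c; exists c.
  - move=> x ox; rewrite (v_spans (fun j => eqP (ox j))) character0; exists 1; rewrite ?rmorph1 //.
have [A [phi [regA phi_inj phiS]]] := IH ul.
have [|||psi [psi_inj psiS _ _]] :=
  @adjoin_character A phi (orthant l) (v j) (m j) _ _ _ phi_inj phiS.
- by rewrite dual_vm eqxx.
- exact: orthant0.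
- by move=> x /(_ j); rewrite (negbTE jl) => /eqP.
exists {poly A}, psi; split=> //; first exact: regular_polynomial.
by rewrite orthant_cons.
Qed.

Lemma orthant_sub_dual l a : monoid_algebra (R := R) (orthant l) `<=`
  monoid_algebra (R := R) (dual_orthant a).
Proof.
move=> _ [s ls ->]; exists s => // t /ls lt j _.
by have := lt j; case: ifP => // _ /eqP ->.
Qed.

Lemma dot_sum_dual (Q : pred J) j : dot (\sum_(i | Q i) m i) (v j) = (Q j)%:R.
Proof.
rewrite dot_suml; under eq_bigr do rewrite dual_vm.
have [Qj|Qj] := boolP (Q j).
  by rewrite (bigD1 j) //= eqxx big1 ?addr0 // => i /andP [_ /negbTE ->].
by apply: big1 => i Qi; case: eqP => // e; rewrite -e Qi in Qj.
Qed.

Lemma not_prime_sum_dual (B P : set K) (Q : pred J) : mul_closed_ring B -> prime_ideal B P ->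
  (forall j, Q j -> B (chi (m j)) /\ ~ P (chi (m j))) -> ~ P (chi (\sum_(i | Q i) m i)).
Proof.
move=> [B1 _ BM] [_ _ _ P1 Pmul] BQ.
suff [] : B (chi (\sum_(i | Q i) m i)) /\ ~ P (chi (\sum_(i | Q i) m i)) by [].
apply: (big_ind (fun x => B (chi x) /\ ~ P (chi x))); [by rewrite character0| |exact: BQ].
move=> x y [Bx Px] [By Py]; rewrite characterD.
by split=> [|/(Pmul _ _ Bx By) []//]; apply: BM.
Qed.

(** * Local rings at the points of a chart *)

Section Chart.
Variable a : pred J.
Let B := monoid_algebra (R := R) (dual_orthant a).
Variable P : set K.
Hypothesis PP : prime_ideal B P.

(** The chart ring is the polynomial ring in all the [chi (m j)] with those outside [a] inverted.
    These are units, hence outside [P], so both rings have the same local ring. *)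
Lemma chart_localization (A : idomainType) (phi : {rmorphism A -> K}) (l : seq J) :
  (forall j, j \in l) -> injective phi ->
  range phi = monoid_algebra (R := R) (orthant l) ->
  localization B P = frac_ring phi (phi @^-1` P).
Proof.
move=> lJ phi_inj phiS.
have sub : range phi `<=` B by rewrite phiS; apply: orthant_sub_dual.
apply: localization_frac_ring => //; first exact: dual_orthant_ring.
rewrite frac_ringE phiS.
pose s := \sum_(i | ~~ a i) m i.
have dual0 : dual_orthant a 0 by move=> j _; rewrite dot0l.
apply: (@monoid_algebra_localized _ _ B _ s) => //.
- exact: orthant_ring.
- exact: orthant0.
- exact: orthant_sub_dual.
- by move=> j; rewrite lJ dot_sum_dual ler0n.
- apply: not_prime_sum_dual PP _ => [|j aj]; first exact: dual_orthant_ring.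
  have Bm : B (chi (m j)).
    by apply: character_algebra => i _; rewrite dual_vm ler0n.
  have Bm' : B (chi (- m j)).
    apply: character_algebra => i ai; rewrite dotNl dual_vm.
    by case: eqP => [e|_]; rewrite ?oppr0 //; move: aj; rewrite e ai.
  split=> // Pm; case: PP => _ _ PM P1 _; apply: P1.
  by rewrite -(character0 R I) -(addNr (m j)) characterD; apply: PM.
(* This sum bounds every coordinate of [x], so the corresponding multiple of [s] clears the negative
   ones, all of which are outside [a]. *)
move=> x ax; exists (\sum_j `|dot x (v j)|)%N => j.
rewrite lJ dotDl dotMnl dot_sum_dual.
have := ax j; case: (boolP (a j)) => /= aj; first by move/(_ isT); rewrite mul0rn addr0.
move=> _; rewrite natz.
have : (`|dot x (v j)| <= \sum_j `|dot x (v j)|)%N by rewrite (bigD1 j) //= leq_addr.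
move: (dot x _) (\sum_j _)%N => y N; lia.
Qed.

Lemma chart_regular : regular_local_ring (localization B P).
Proof.
have [A [phi [regA phi_inj phiS]]] := orthant_model (enum_uniq J).
rewrite (@chart_localization _ phi (enum J)) // => [|j]; last by rewrite mem_enum.
have pp : is_prime (phi @^-1` P).
  by apply: prime_ideal_preimage PP; rewrite phiS; apply: orthant_sub_dual.
by apply: regular_frac => //; apply: regA.
Qed.

(** The variable [chi (m j)] is adjoined last, to a coefficient ring that already contains
    [chi (m i)]. *)
Lemma chart_krull_dim i j : i != j -> P (chi (m i)) -> P (chi (m j)) ->
  krull_dim_ge (localization B P) 2.
Proof.
move=> ij Pi Pj; pose l := rem j (enum J).
have jl : j \notin l by rewrite mem_rem_uniq ?enum_uniq // inE eqxx.
have il : i \in l by rewrite mem_rem_uniq ?enum_uniq // inE ij mem_enum.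
have [A [phi [regA phi_inj phiS]]] := orthant_model (rem_uniq j (enum_uniq J)).
have [|||psi [psi_inj psiS psiX psiC]] :=
  @adjoin_character A phi (orthant l) (v j) (m j) _ _ _ phi_inj phiS.
- by rewrite dual_vm eqxx.
- exact: orthant0.
- by move=> x /(_ j); rewrite (negbTE jl) => /eqP.
rewrite -orthant_cons // in psiS.
rewrite (chart_localization _ psi_inj psiS) => [|k]; last first.
  by rewrite inE mem_rem_uniq ?enum_uniq // inE mem_enum andbT orbN.
have pp : is_prime (psi @^-1` P).
  by apply: prime_ideal_preimage PP; rewrite psiS; apply: orthant_sub_dual.
have [c _ ec] : range phi (chi (m i)).
  rewrite phiS; apply: character_algebra => k; rewrite dual_vm ler0n.
  by case: ifP => // kl; case: (i =P k) => // e; rewrite -e il in kl.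
have c0 : c != 0.
  by apply: contraTneq (character_neq0 R (m i)) => c0; rewrite -ec c0 rmorph0 eqxx.
(* The chain consists of zero, the ideal of the variable, and the trace of [P]. The variable
   separates the first two, and the constant [c], which maps to [chi (m i)], the last two. *)
pose q (k : nat) : set {poly A} := match k with
  0 => [set f | f = 0] | 1 => [set f | f`_0 = 0] | _ => psi @^-1` P end.
apply: (@krull_dim_frac _ _ psi psi_inj _ pp q 2) => //.
- move=> [|[|[|//]]] _ //; split; rewrite /q /=.
  + by [].
  + by move=> f g -> ->; rewrite addr0.
  + by move=> f g ->; rewrite mulr0.
  + by apply/eqP; rewrite oner_eq0.
  + by move=> f g /eqP; rewrite mulf_eq0 => /orP [] /eqP; [left|right].
  + by rewrite coef0.
  + by move=> f g f0 g0; rewrite coefD f0 g0 addr0.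
  + by move=> f g g0; rewrite coef0M g0 mulr0.
  + by rewrite coef1; apply/eqP; rewrite oner_eq0.
  + by move=> f g /eqP; rewrite coef0M mulf_eq0 => /orP [] /eqP; [left|right].
- move=> [|[|//]] _; rewrite /q; split=> /=.
  + by move=> f ->; rewrite coef0.
  + move=> /(_ 'X); rewrite /= coefX => /(_ erefl) /eqP.
    by rewrite polyX_eq0.
  + move=> f /= f0; have /factor_theorem [g ->] : root f 0 by rewrite /root horner_coef0 f0.
    rewrite subr0 /preimage /= rmorphM psiX.
    case: PP => _ _ PM _ _; apply: PM => //.
    by apply: (orthant_sub_dual (l := j :: l)); rewrite -psiS; exists g.
  + move=> /(_ c%:P); rewrite /preimage /= psiC ec coefC => /(_ Pi) /eqP.
    by rewrite (negbTE c0).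
Qed.

(** The point lies in the smaller chart of the face on the [v j] whose variable vanishes at it,
    since the other variables are invertible there. *)
Lemma chart_specialize : exists2 P',
  prime_ideal (monoid_algebra (R := R) (dual_orthant (fun j => a j && `[< P (chi (m j)) >]))) P' &
  localization (monoid_algebra (R := R)
    (dual_orthant (fun j => a j && `[< P (chi (m j)) >]))) P' = localization B P.
Proof.
set b := (fun j => a j && _).
have Bring := dual_orthant_ring a.
apply: localization_overring => //; first exact: dual_orthant_ring.
  by move=> _ [s ss ->]; exists s => // t /ss ts j /andP [aj _]; apply: ts.
apply: (@monoid_algebra_localized _ _ B _ (\sum_(j | a j && ~~ b j) m j)) => //.
- by move=> j _; rewrite dot0l.
- by move=> j _; rewrite dot_sum_dual ler0n.
- apply: not_prime_sum_dual PP _ => // j /andP [aj]; rewrite /b aj /= => /asboolPn Pj.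
  by split=> //; apply: character_algebra => i _; rewrite dual_vm ler0n.
move=> x bx; exists (\sum_j `|dot x (v j)|)%N => j aj.
rewrite dotDl dotMnl dot_sum_dual aj /=.
have := bx j; case: (boolP (b j)) => /= bj; first by move/(_ isT); rewrite mul0rn addr0.
move=> _; rewrite natz.
have : (`|dot x (v j)| <= \sum_j `|dot x (v j)|)%N by rewrite (bigD1 j) //= leq_addr.
move: (dot x _) (\sum_j _)%N => y N; lia.
Qed.

End Chart.
End DualBases.
End Models.

(** * Polyhedra *)

Section Polyhedra.
Variables (R : realType) (I : finType).
Local Notation ZI := {ffun I -> int}.
Local Notation RI := {ffun I -> R^o}.
Implicit Types (x y z v g h : RI).

Lemma dotZl (c : R) x y : (dot (c *: x) y : R) = c * (dot x y : R).
Proof.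
by rewrite /dot big_distrr; apply: eq_bigr => j _; rewrite ffunE -mulrA.
Qed.

Lemma dotZr (c : R) x y : (dot x (c *: y) : R) = c * (dot x y : R).
Proof. by rewrite dotC dotZl dotC. Qed.

Lemma dotDr x y z : (dot x (y + z) : R) = dot x y + dot x z.
Proof. by rewrite dotC dotDl ![dot _ x]dotC. Qed.

Lemma dot_toR (m w : ZI) : (dot (toR R m) (toR R w) : R) = (dot m w)%:~R.
Proof. by rewrite /dot rmorph_sum; apply: eq_bigr => j _; rewrite !ffunE rmorphM. Qed.

(** Induction on the number of generators (Bartl): if the last constraint is
    needed, some [x] violates only it, and projecting along [x] removes it. *)
Lemma farkas (gs : seq RI) v :
  (forall y, (forall g, g \in gs -> 0 <= (dot g y : R)) -> 0 <= (dot v y : R)) ->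
  exists2 c : nat -> R, (forall k, 0 <= c k) & v = \sum_(k < size gs) c k *: gs`_k.
Proof.
move: {2}(size gs) (erefl (size gs)) => n; elim: n gs v => [|n IH] [|g gs] v //.
  move=> _ vpos.
  exists (fun=> 0) => //; rewrite big_ord0; apply/ffunP => j.
  have pos y : 0 <= (dot v y : R) by apply: vpos.
  have : (dot v v : R) = 0.
    apply/le_anti; rewrite pos andbT.
    by have := pos (- v); rewrite dotC dotNl oppr_ge0.
  move=> /eqP; rewrite psumr_eq0 => [/allP /(_ j)|i _]; last exact: sqr_ge0.
  by rewrite mem_index_enum /= => /(_ isT); rewrite mulf_eq0 orbb ffunE => /eqP.
move=> /= [sgs] vpos.
have [vpos'|] := pselect (forall y, (forall h, h \in gs -> 0 <= (dot h y : R)) ->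
                          0 <= (dot v y : R)).
  have [c c0 ->] := IH gs v sgs vpos'.
  exists (fun k => if k is k'.+1 then c k' else 0); first by case.
  by rewrite big_ord_recl /= scale0r add0r.
move=> /existsNP [x /not_implyP [xgs /negP]]; rewrite -ltNge => vx.
have gx : (dot g x : R) < 0.
  rewrite ltNge; apply/negP => gx; move: vx; rewrite ltNge vpos // => h.
  by rewrite inE => /orP [/eqP ->|/xgs].
(* [proj h] is [h] made orthogonal to [x] by a multiple of [g]; dually, [y] is moved along [x] into
   the hyperplane orthogonal to [g]. *)
pose proj h : RI := h - (dot h x / dot g x : R) *: g.
have projE h y : (dot (proj h) y : R) = dot h (y - (dot g y / dot g x : R) *: x).
  by rewrite dotBl dotZl [in RHS]dotC dotBl dotZl ![dot _ h]dotC; field; rewrite lt_eqF.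
have [y|c c0 e] := IH (map proj gs) (proj v) (etrans (size_map _ _) sgs).
  move=> ypos; rewrite projE; apply: vpos => h; rewrite inE => /orP [/eqP ->|hgs].
    by rewrite dotC dotBl dotZl ![dot _ g]dotC divfK ?lt_eqF // subrr.
  by rewrite -projE; apply: ypos; apply: map_f.
(* The coefficient of [g] collects the multiples removed by the projections. It is nonnegative
   because [x] is negative on [v] and [g] and nonnegative on [gs]. *)
exists (fun k => if k is k'.+1 then c k' else
  dot v x / dot g x - \sum_(k < size gs) c k * (dot gs`_k x / dot g x)) => [[|k]//|].
  rewrite subr_ge0 (@le_trans _ _ 0) //; last by rewrite ltW // nmulr_rgt0 ?invr_lt0.
  apply: sumr_le0 => k _; rewrite mulr_ge0_le0 // mulr_ge0_le0 ?invr_le0 ?(ltW gx) //.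
  exact/xgs/mem_nth.
rewrite big_ord_recl /= -[LHS](subrK ((dot v x / dot g x : R) *: g)) [LHS]addrC.
rewrite -/(proj v) e size_map scalerBl scaler_suml -addrA; congr (_ + _).
rewrite -sumrN -big_split /=; apply: eq_bigr => k _.
by rewrite (nth_map 0) // /proj scalerBr scalerA addrC.
Qed.

Lemma cone_farkas (gs : seq ZI) v :
  (forall y, (forall g : ZI, g \in gs -> 0 <= (dot (toR R g) y : R)) -> 0 <= (dot v y : R)) ->
  cone gs v.
Proof.
move=> vpos; have [y ypos|c c0 e] := @farkas (map (@toR R I) gs) v.
  by apply: vpos => g ggs; apply: ypos; apply: map_f.
exists c => //; rewrite e size_map; apply: eq_bigr => k _.
by rewrite (nth_map 0).
Qed.

Lemma dot_cone (gs : seq ZI) x y v : cone gs v ->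
  (forall g : ZI, g \in gs -> (dot x (toR R g) : R) <= dot y (toR R g)) ->
  (dot x v : R) <= dot y v.
Proof.
move=> [c c0 ->] xy; rewrite ![dot _ (\sum_(k < _) _)]dotC !dot_suml.
apply: ler_sum => k _; rewrite ![dot (_ *: _) _]dotC !dotZr ler_wpM2l //.
by apply: xy; apply: mem_nth.
Qed.

(** Here [s j] is the slack of a constraint and [t j] its rate of change along a direction: positive
    slack absorbs a short step, and a tight constraint has [t j] nonnegative. *)
Lemma small_step (J : Type) (r : seq J) (s t : J -> R) :
  (forall j, 0 <= s j) -> (forall j, s j = 0 -> 0 <= t j) ->
  exists2 e : R, 0 < e & all (fun j => 0 <= s j + e * t j) r.
Proof.
move=> s0 t0; elim: r => [|j r [e e0 IH]]; first by exists 1.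
have [d d0 jd] : exists2 d : R, 0 < d & forall c, 0 <= c <= d -> 0 <= s j + c * t j.
  have [sj|sj] := eqVneq (s j) 0.
    by exists 1 => // c /andP [c0 _]; rewrite sj add0r mulr_ge0 ?t0.
  have sp : 0 < s j by rewrite lt_neqAle eq_sym sj s0.
  have np : 0 < 1 + `|t j| by rewrite ltr_wpDr.
  exists (s j / (1 + `|t j|)) => [|c /andP [c0]]; first by rewrite divr_gt0.
  rewrite ler_pdivlMr // => cs.
  have : c * - t j <= c * (1 + `|t j|).
    apply: ler_wpM2l => //; have := ler_norm (- t j); rewrite normrN; lra.
  lra.
have md : 0 < Num.min e d by rewrite lt_min e0 d0.
exists (Num.min e d) => //=; rewrite jd ?(ltW md) ?ge_min ?lexx ?orbT //=.
apply: sub_all IH => i ie; have := s0 i; have := ie.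
have [ti|ti] := lerP 0 (t i); first by move=> _ si; rewrite addr_ge0 // mulr_ge0 // ltW.
have := ler_wnM2r (ltW ti) (_ : Num.min e d <= e); rewrite ge_min lexx => /(_ isT); lra.
Qed.

(** A direction nonnegative on the normals tight at [x] stays in [D] for a short step, so a form
    minimal at [x] is nonnegative on it. Farkas' lemma then writes the form in the tight normals. *)
Lemma normal_cone_polyhedron (E : finType) (n : E -> ZI) (b : E -> R) (Q : pred E)
    (D : set RI) x :
  (forall y, D y <-> forall e, Q e -> b e <= (dot (toR R (n e)) y : R)) -> D x ->
  normal_cone D x =
  @cone R I [seq n e | e <- enum E & Q e && ((dot (toR R (n e)) x : R) == b e)].
Proof.
move=> DE Dx; set act := [seq e <- _ | _].
have actP e : e \in act = Q e && ((dot (toR R (n e)) x : R) == b e).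
  by rewrite mem_filter mem_enum andbT.
apply/seteqP; split=> v.
  move=> vmin; apply: cone_farkas => y ypos.
  have [||d d0 /allP xd] := @small_step _ (enum [pred e | Q e])
      (fun e => if Q e then dot (toR R (n e)) x - b e else 0)
      (fun e => if Q e then dot (toR R (n e)) y else 0).
    - by move=> e; case: ifP => // Qe; rewrite subr_ge0; apply: (DE x).1.
    - move=> e; case: ifP => // Qe /eqP; rewrite subr_eq0 => xe.
      by apply/ypos/map_f; rewrite actP Qe.
    have /vmin : D (x + d *: y).
      apply/DE => e Qe; have := xd e; rewrite mem_enum inE Qe => /(_ isT).
      by rewrite dotDr dotZr; lra.
    by rewrite dotDl dotZl lerDl pmulr_rge0 // dotC.
move=> vc y Dy; apply: dot_cone vc _ => _ /mapP [e + ->].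
by rewrite actP => /andP [Qe /eqP xe]; rewrite ![dot _ (toR _ _)]dotC xe; apply: (DE y).1.
Qed.
End Polyhedra.

(** * The normal fan of the order polytope *)

Section GraphVectors.
Variable J : finType.

Definition indicator (o : option J) : {ffun J -> int} := [ffun j => (o == Some j)%:R].

(** The vertices [Some j] are independent, and [None] stands for [0]. *)
Definition edge_vector (e : option J * option J) : {ffun J -> int} :=
  indicator e.2 - indicator e.1.

Lemma edge_vectorE e j : edge_vector e j = (e.2 == Some j)%:R - (e.1 == Some j)%:R.
Proof. by rewrite !ffunE. Qed.

Lemma dot_indicator (R : realType) (o : option J) (x : {ffun J -> R^o}) :
  (dot (toR R (indicator o)) x : R) = oapp x 0 o.
Proof.
rewrite /dot; case: o => [i|] /=.
  rewrite (bigD1 i) //= big1 ?addr0 => [|j ji]; rewrite !ffunE ?eqxx ?mul1r //.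
  by rewrite -[Some i == Some j]/(i == j) eq_sym (negbTE ji) mul0r.
by apply: big1 => j _; rewrite !ffunE mul0r.
Qed.

Lemma dot_edge_vector (R : realType) e (x : {ffun J -> R^o}) :
  (dot (toR R (edge_vector e)) x : R) = oapp x 0 e.2 - oapp x 0 e.1.
Proof.
rewrite -!dot_indicator -dotBl; congr (dot _ x).
by apply/ffunP => j; rewrite !ffunE rmorphB.
Qed.

End GraphVectors.

Section OrderPolytope.
Variables (R : realType) (d : Order.disp_t) (P : finPOrderType d).
Implicit Types (a b : option P) (e : option P * option P) (x : {ffun P -> R^o}).

(** Pairs [(a, b)] of elements of [P] with a bottom and a top adjoined: the
    bottom is [None] on the left, the top is [None] on the right. *)
Definition lt_hat a b : bool :=
  match a, b with Some u, Some v => (u < v)%O | _, _ => true end.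

(** The pair of bottom and top, which would be a cover for empty [P], is excluded because its vector
    is zero. *)
Definition hasse e : bool :=
  [&& e != (None, None), lt_hat e.1 e.2 &
      [forall w, ~~ (lt_hat e.1 (Some w) && lt_hat (Some w) e.2)]].

(** The top has coordinate 1 in the inequalities but 0 in [edge_vector], whence the constant
    [-1]. *)
Definition rhs e : R := if e.2 is None then -1 else 0.

Lemma order_polytopeP x :
  order_polytope R P x <->
  (forall e, hasse e -> rhs e <= (dot (toR R (edge_vector e)) x : R)).
Proof.
split=> [[x01 xmon] [a b] /and3P [ab0 ab _]|xh].
  rewrite dot_edge_vector /rhs /=; case: a b ab ab0 => [u|] [v|] //= uv _.
  - by rewrite subr_ge0 xmon.
  - by have := x01 u; lra.
  - by have := x01 v; lra.
(* Every relation is a composite of covers, by induction on the number of elements strictly between.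
   The defaults 0 and 1 are the coordinates of bottom and top. *)
have gap a b : lt_hat a b -> oapp x 0 a <= oapp x (1 : R) b.
  have [n] := ubnP #|[pred w | lt_hat a (Some w) && lt_hat (Some w) b]|.
  elim: n a b => // n IH a b /ltnSE cn ab.
  have lt_hat_trans a' w b' : lt_hat a' (Some w) -> lt_hat (Some w) b' -> lt_hat a' b'.
    by case: a' b' => [u|] [v|] //=; apply: lt_trans.
  have [/existsP [w /andP [aw wb]]|/existsPn none] :=
      boolP [exists w, lt_hat a (Some w) && lt_hat (Some w) b].
    apply: (@le_trans _ _ (x w : R)).
      apply: (IH a (Some w)) => //; apply: leq_trans cn; apply: proper_card.
      apply/fintype.properP; split; last by exists w; [rewrite inE aw|rewrite inE aw /= ltxx].
      apply/fintype.subsetP => z; rewrite !inE => /andP [az zw]; rewrite az /=.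
      exact: lt_hat_trans zw wb.
    apply: (IH (Some w) b) => //; apply: leq_trans cn; apply: proper_card.
    apply/fintype.properP; split; last by exists w; [rewrite inE aw|rewrite inE /= ltxx].
    apply/fintype.subsetP => z; rewrite !inE => /andP [wz zb]; rewrite zb andbT.
    exact: lt_hat_trans aw wz.
  have [[-> ->]|ab0] := eqVneq (a, b) (None, None); first by rewrite /= ler01.
  have /xh : hasse (a, b) by rewrite /hasse ab0 /= ab; apply/forallP.
  by rewrite dot_edge_vector /rhs; case: (b) => [v|] /=; lra.
split=> [u|u v uv]; last exact: (gap (Some u) (Some v)).
by rewrite (gap None (Some u)) // (gap (Some u) None).
Qed.

(** Heights are extended by 0 at the bottom and, in [up], by [#|P|.+1] at the top. *)
Definition low (f : P -> nat) a : nat := if a is Some u then f u else 0.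
Definition up (f : P -> nat) b : nat := if b is Some v then f v else #|P|.+1.

Definition down (w : P) : nat := #|[pred z | (z <= w)%O]|.

Lemma down_gt0 w : (0 < down w)%N.
Proof. by apply/card_gt0P; exists w; rewrite inE. Qed.

Lemma down_le w : (down w < #|P|.+1)%N.
Proof. by rewrite ltnS max_card. Qed.

Lemma down_lt u v : (u < v)%O -> (down u < down v)%N.
Proof.
move=> uv; apply: proper_card; apply/fintype.properP; split.
  by apply/fintype.subsetP => z; rewrite !inE => /le_trans; apply; apply: ltW.
by exists v; rewrite !inE ?lexx // lt_geF.
Qed.

(** For an edge [(u, v)] inside [P], [f w] counts the elements below [w] in the
    order obtained by identifying [u] and [v]. *)
Lemma facet_height e : hasse e -> exists f : P -> nat,
  low f e.1 = up f e.2 /\ (forall a b, lt_hat a b -> (a, b) != e -> (low f a < up f b)%N).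
Proof.
case: e => a0 b0 /and3P [/= ab0 ab /forallP none]; case: a0 b0 ab0 ab none => [u|] [v|] //= _.
- move=> uv none; pose f w := #|[pred z | (z <= w)%O || ((z <= v)%O && (u <= w)%O)]|.
  have fS w : (0 < f w < #|P|.+1)%N.
    by rewrite ltnS max_card andbT; apply/card_gt0P; exists w; rewrite inE lexx.
  exists f; split.
    apply: eq_card => z; rewrite !inE lexx andbT (ltW uv) andbT orbb.
    by apply/orb_idl => /le_trans; apply; apply: ltW.
  move=> [w|] [w'|] //= => [ww'|_|_] ne; [|by case/andP: (fS w)|by case/andP: (fS w')].
  apply: proper_card; apply/fintype.properP; split.
    apply/fintype.subsetP => z; rewrite !inE => /orP [zw|/andP [-> uw]].
      by rewrite (le_trans zw (ltW ww')).
    by rewrite (le_trans uw (ltW ww')) orbT.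
  exists w'; rewrite !inE ?lexx // lt_geF //=; apply/negP => /andP [w'v uw].
  move/eqP: ne; case.
  have -> : w = u.
    apply/eqP; have := none w; rewrite (lt_le_trans ww' w'v) andbT.
    by rewrite lt_neqAle uw andbT negbK eq_sym.
  have -> // : w' = v.
  by apply/eqP; have := none w'; rewrite (le_lt_trans uw ww') /= lt_neqAle w'v andbT negbK.
(* Here [u] is maximal and is raised to the height of the top; in the next case a minimal [v] is
   lowered to that of the bottom. *)
- move=> _ none; exists (fun w => if w == u then #|P|.+1 else down w); split=> /=.
    by rewrite eqxx.
  move=> [w|] [w'|] //= => [ww'|_|_] ne.
  + have /negbTE -> : w != u by apply: contraTneq (none w') => wu; rewrite -wu ww'.
    by case: ifP => _; [apply: down_le|apply: down_lt].
  + by move: ne; have [->|_ _] := eqVneq w u; rewrite ?eqxx ?down_le.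
  + by case: ifP => // _; apply: down_gt0.
- move=> _ none; exists (fun w => if w == v then 0 else down w)%N; split=> /=.
    by rewrite eqxx.
  move=> [w|] [w'|] //= => [ww'|_|_] ne.
  + have /negbTE -> : w' != v by apply: contraTneq (none w) => wv; rewrite -wv ww'.
    by case: ifP => _; [apply: down_gt0|apply: down_lt].
  + by case: ifP => // _; apply: down_le.
  + by move: ne; have [->|_ _] := eqVneq w' v; rewrite ?eqxx ?down_gt0.
Qed.

(** Divided by [#|P|.+1], the height [f] is a point of the polytope at which exactly the Hasse edges
    in [A] are tight. *)
Lemma normal_cone_height (f : P -> nat) (A : pred (option P * option P)) :
  (forall e, hasse e -> if A e then low f e.1 = up f e.2 else (low f e.1 < up f e.2)%N) ->
  hibi_fan R P (@cone R P
    [seq edge_vector e | e <- enum {: option P * option P} & hasse e && A e]).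
Proof.
move=> fA; pose x : {ffun P -> R^o} := [ffun w => (f w)%:R / #|P|.+1%:R].
have N0 : (0 : R) < #|P|.+1%:R by rewrite ltr0n.
have gap e : (dot (toR R (edge_vector e)) x : R) - rhs e =
    ((up f e.2)%:R - (low f e.1)%:R) / #|P|.+1%:R.
  have N1 : (1 + #|P|%:R : R) != 0 by rewrite gt_eqF // ltr_wpDr.
  by rewrite dot_edge_vector /rhs; case: e => [[u|] [v|]] /=; rewrite ?ffunE; field; exact: N1.
have Dx : order_polytope R P x.
  apply/order_polytopeP => e he; rewrite -subr_ge0 gap divr_ge0 ?ler0n // subr_ge0 ler_nat.
  by have := fA e he; case: ifP => _ => [->|/ltnW].
exists x => //; rewrite (normal_cone_polyhedron order_polytopeP Dx); congr cone.
congr map; apply: eq_filter => e; apply: andb_id2l => he.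
rewrite -subr_eq0 gap mulf_eq0 invr_eq0 [X in _ || X]gt_eqF // orbF subr_eq0 eqr_nat.
have := fA e he; case: ifP => _ => [->|]; first by rewrite eqxx.
by move=> lt; rewrite gtn_eqF.
Qed.

(** The height [down] is strictly increasing and strictly between bottom and top, so no inequality
    is tight. *)
Lemma hibi_fan0 : hibi_fan R P (@cone R P [::]).
Proof.
have := @normal_cone_height down pred0; rewrite (eq_filter (a2 := pred0)) => [|e].
  rewrite filter_pred0; apply=> -[[u|] [v|]] //= /and3P [_ /= uv _].
  - exact: down_lt.
  - exact: down_le.
  - exact: down_gt0.
by rewrite andbF.
Qed.

(** Every Hasse edge defines a facet: [facet_height] provides a point where it alone is tight. *)
Lemma hibi_ray e : hasse e -> hibi_fan R P (@cone R P [:: edge_vector e]).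
Proof.
move=> he; have [f [fe flt]] := facet_height he.
have := @normal_cone_height f (pred1 e); rewrite (eq_filter (a2 := pred1 e)) => [|e'].
  rewrite filter_pred1_uniq ?enum_uniq ?mem_enum //; apply=> e' he' /=.
  case: eqP => [->//|/eqP ne]; apply: flt; last by case: (e') ne.
  by case/and3P: he'.
by rewrite /= andbC; apply: andb_idr => /eqP ->.
Qed.

Lemma hibi_coneP sigma : hibi_fan R P sigma -> exists2 s : seq (option P * option P),
  all hasse s & sigma = @cone R P [seq edge_vector e | e <- s].
Proof.
move=> [x Dx <-]; rewrite (normal_cone_polyhedron order_polytopeP Dx).
by eexists; last reflexivity; apply/allP => e; rewrite mem_filter => /andP [/andP []].
Qed.

End OrderPolytope.

(** * Edge vectors *)

Section Terminality.
Variables (R : realType) (J : finType).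

(** The terms [c k * (h - f k)] are nonnegative and their sum is at most zero. *)
Lemma extreme_average N (c f : 'I_N -> R) (h : R) :
  (forall k, 0 <= c k) -> \sum_k c k = 1 -> (forall k, 0 < c k -> f k <= h) ->
  h <= \sum_k c k * f k -> \sum_k c k * f k = h /\ (forall k, 0 < c k -> f k = h).
Proof.
move=> c0 c1 fh hle.
have ge0 k : 0 <= c k * (h - f k).
  have := c0 k; rewrite le_eqVlt => /orP [/eqP <-|ck]; first by rewrite mul0r.
  by rewrite mulr_ge0 // subr_ge0 fh.
have e : \sum_k c k * (h - f k) = h - \sum_k c k * f k.
  by under eq_bigr do rewrite mulrBr; rewrite sumrB -mulr_suml c1 mul1r.
have e0 : \sum_k c k * (h - f k) = 0.
  by apply/le_anti; rewrite sumr_ge0 ?andbT ?e ?subr_le0.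
split=> [|k ck]; first by apply/esym/eqP; rewrite -subr_eq0 -e e0.
move/eqP: e0; rewrite psumr_eq0 // => /allP /(_ k); rewrite mem_index_enum => /(_ isT).
by rewrite /= mulf_eq0 (gt_eqF ck) subr_eq0 => /eqP.
Qed.

(** Entries are at most 1 and [v w] is a positive integer, so all edges of positive weight have head
    [w]. Their entries elsewhere are 0 or -1, and an integer average of these is again extreme, so
    these edges all agree with [v]. *)
Lemma average_edges_pos N (c : 'I_N -> R) (e : 'I_N -> option J * option J)
    (v : {ffun J -> int}) w :
  (forall k, 0 <= c k) -> \sum_k c k = 1 ->
  (forall j, (v j)%:~R = \sum_k c k * (edge_vector (e k) j)%:~R) ->
  0 < v w -> exists k, v = edge_vector (e k).
Proof.
move=> c0 c1 ve vw.
have [||_ ew1] := extreme_average c0 c1 (f := fun k => (edge_vector (e k) w)%:~R) (h := 1).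
- by move=> k _; rewrite edge_vectorE (ler_int _ _ 1); do 2 case: eqP.
- by rewrite -ve (ler_int _ 1).
have ew k : 0 < c k -> (e k).2 = Some w.
  move=> /ew1 /eqP; rewrite (eqr_int _ _ 1) edge_vectorE.
  by case: ((e k).2 =P Some w) => // _; case: ((e k).1 =P Some w).
have [k ck] : exists k, 0 < c k.
  apply: contrapT => /forallNP none; move: c1; rewrite big1 => [|k _]; first lra.
  by apply/le_anti; rewrite c0 andbT leNgt; apply/negP.
exists k; apply/ffunP => j; apply: (@intr_inj R).
have c_eq (f g : 'I_N -> R) : (forall i, 0 < c i -> f i = g i) ->
    \sum_i c i * f i = \sum_i c i * g i.
  move=> fg; apply: eq_bigr => i _; have := c0 i.
  by rewrite le_eqVlt => /orP [/eqP <-|/fg ->//]; rewrite !mul0r.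
have sum_const h : \sum_i c i * h = h by rewrite -mulr_suml c1 mul1r.
have [->|jw] := eqVneq j w.
  by rewrite ve (ew1 _ ck) -[RHS]sum_const; apply: c_eq => i /ew1.
have ej i : 0 < c i -> edge_vector (e i) j = - ((e i).1 == Some j)%:R.
  by move=> ci; rewrite edge_vectorE (ew _ ci) (inj_eq Some_inj) eq_sym (negbTE jw) sub0r.
have : v j <= -1 \/ 0 <= v j by lia.
case=> vj.
  have [||vE eE] := extreme_average c0 c1 (f := fun i => - (edge_vector (e i) j)%:~R) (h := 1).
  - by move=> i /ej ->; case: eqP => _; rewrite ?oppr0 ?opprK.
  - under eq_bigr do rewrite mulrN.
    by rewrite sumrN -ve -mulrNz (ler_int _ 1); lia.
  move: vE; under eq_bigr do rewrite mulrN.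
  by rewrite sumrN -ve => vE; apply: oppr_inj; rewrite vE eE.
have [||vE eE] := extreme_average c0 c1 (f := fun i => (edge_vector (e i) j)%:~R) (h := 0).
- by move=> i /ej ->; case: eqP => _; rewrite ?oppr0 ?rmorphN1 ?lerN10.
- by rewrite -ve (ler_int _ 0).
by rewrite ve vE eE.
Qed.

(** A nonzero coordinate is [1] or [-1], which forces a common head or tail on
    the edges of positive weight. *)
Lemma average_edges N (c : 'I_N -> R) (e : 'I_N -> option J * option J)
    (v : {ffun J -> int}) :
  (forall k, 0 <= c k) -> \sum_k c k = 1 ->
  (forall j, (v j)%:~R = \sum_k c k * (edge_vector (e k) j)%:~R) ->
  v != 0 -> exists k, v = edge_vector (e k).
Proof.
move=> c0 c1 ve v0.
have [w vw] : exists w, v w != 0.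
  apply: contrapT => /forallNP none; move/eqP: v0; apply; apply/ffunP => w.
  by rewrite ffunE; apply/eqP/negPn/negP.
have [vw0|vw0] : 0 < v w \/ 0 < - v w by lia.
  exact: average_edges_pos c0 c1 ve vw0.
(* Reversing all edges turns a negative coordinate into a positive one. *)
have swap k : edge_vector ((e k).2, (e k).1) = - edge_vector (e k) by rewrite /edge_vector opprB.
have [||k vk] := @average_edges_pos _ c (fun k => ((e k).2, (e k).1)) (- v) w c0 c1.
- move=> j; rewrite ffunE mulrNz ve -sumrN; apply: eq_bigr => k _.
  by rewrite swap [(- _ : {ffun _ -> _}) j]ffunE mulrNz mulrN.
- by rewrite ffunE.
by exists k; apply: oppr_inj; rewrite vk swap.
Qed.

End Terminality.

(** * Unimodularity and dual lattice bases *)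

Section DualBasis.

(** Expand along a row with a single nonzero entry; if there is none, the
    entries of each row sum to zero. *)
Lemma det_edge_vectors n (e : 'I_n -> option 'I_n * option 'I_n) :
  let A : 'M[int]_n := \matrix_(i, j) edge_vector (e i) j in
  \det A != 0 -> \det A \is a GRing.unit.
Proof.
(* The ends of an edge differ as booleans when exactly one of them is [None]; its row then has a
   single nonzero entry. *)
elim: n e => [|n IH] e A; first by rewrite det_mx00.
have [/existsP [i0 ei0]|/existsPn none] := boolP [exists i, (e i).1 != (e i).2 :> bool].
  have [j0 [s [Ai0 su]]] : exists j0 s, (forall j, A i0 j = if j == j0 then s else 0) /\
      s \is a GRing.unit.
    case E : (e i0) ei0 => [[u|] [v|]] //= _.
      exists u, (-1); split=> // j; rewrite mxE edge_vectorE E /= sub0r (inj_eq Some_inj) eq_sym.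
      by case: eqP; rewrite ?oppr0.
    exists v, 1; split=> // j; rewrite mxE edge_vectorE E /= subr0 (inj_eq Some_inj) eq_sym.
    by case: eqP.
  have -> : \det A = s * cofactor A i0 j0.
    rewrite (expand_det_row A i0) (bigD1 j0) //= Ai0 eqxx big1 ?addr0 // => j /negbTE jj.
    by rewrite Ai0 jj mul0r.
  (* Deleting column [j0] merges the vertex [j0] with [None], so the minor is again a matrix of edge
     vectors. *)
  pose e' i := (obind (unlift j0) (e (lift i0 i)).1, obind (unlift j0) (e (lift i0 i)).2).
  have AE : row' i0 (col' j0 A) = \matrix_(i, j) edge_vector (e' i) j.
    have E (o : option 'I_n.+1) j : (obind (unlift j0) o == Some j) = (o == Some (lift j0 j)).
      case: o => [k|] //=; case: unliftP => [k' ->|->].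
        by rewrite !(inj_eq Some_inj) (inj_eq lift_inj).
      by rewrite (inj_eq Some_inj) (negbTE (neq_lift _ _)).
    by apply/matrixP => i j; rewrite !mxE !edge_vectorE !E.
  rewrite /cofactor AE unitrM su unitrM unitrX ?unitrN1 //= => s0; apply: IH.
  by apply: contraNneq s0 => ->; rewrite mulr0 mulr0.
rewrite -det_tr => /negP []; apply/det0P; exists (const_mx 1).
  by apply/eqP => /matrixP /(_ 0 0) /eqP; rewrite !mxE oner_eq0.
apply/matrixP => i0 i; rewrite !mxE.
under eq_bigr do rewrite !mxE mul1r edge_vectorE.
rewrite sumrB; have sumE (o : option 'I_n.+1) : \sum_j (o == Some j)%:R = (o : bool)%:R :> int.
  case: o => [k|]; last by rewrite big1.
  rewrite (bigD1 k) //= eqxx big1 ?addr0 // => j /negbTE jk.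
  by rewrite (inj_eq Some_inj) eq_sym jk.
by rewrite !sumE; have /negPn /eqP -> := none i; rewrite subrr.
Qed.

(** The added vectors stay in the family [f], so that edge vectors can be completed by edge
    vectors. *)
Lemma extend_free (F : fieldType) (vT : vectType F) (T : eqType) (f : T -> vT) (s l : seq T) :
  free (map f s) -> exists t, free (map f (s ++ t)) /\
    forall x, x \in l -> f x \in <<map f (s ++ t)>>%VS.
Proof.
move=> sfree; elim: l => [|x l [t [tfree tspan]]]; first by exists [::]; rewrite cats0.
have [xt|xt] := boolP (f x \in <<map f (s ++ t)>>%VS).
  by exists t; split=> // y; rewrite inE => /orP [/eqP ->//|/tspan].
exists (rcons t x); rewrite -rcons_cat map_rcons; split.
  by rewrite (perm_free (_ : perm_eq _ (f x :: map f (s ++ t)))) ?perm_rcons // free_cons xt.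
have sub : {subset map f (s ++ t) <= rcons (map f (s ++ t)) (f x)}.
  by move=> y yt; rewrite mem_rcons inE yt orbT.
move=> y; rewrite inE => /orP [/eqP ->|/tspan].
  by apply: memv_span; rewrite mem_rcons mem_head.
by apply: subvP; apply: sub_span.
Qed.

Variables (R : realType) (J : finType).
Local Notation E := (option J * option J)%type.
Local Notation real_vector := (fun e : E => toR R (edge_vector e)).

Lemma complete_edges (s : seq E) : free (map real_vector s) ->
  exists2 t : seq E, free (map real_vector (s ++ t)) & size (s ++ t) = #|J|.
Proof.
move=> /(extend_free [seq (None, Some w) | w <- enum J]) [t [tfree tspan]].
exists t => //; have tbasis : basis_of fullv (map real_vector (s ++ t)).
  rewrite /basis_of tfree andbT eqEsubv subvf /=; apply/subvP => x _.
  have -> : x = \sum_w (x w : R) *: real_vector (None, Some w).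
    apply/ffunP => j; rewrite sum_ffunE (bigD1 j) //= big1 ?addr0 => [|w wj].
      by rewrite !ffunE eqxx /= subr0 /GRing.scale /= mulr1.
    rewrite !ffunE (inj_eq Some_inj) (negbTE wj) /= subr0 /GRing.scale /= mulr0 //.
  by apply: memv_suml => w _; apply/memvZ/tspan/map_f; rewrite mem_enum.
rewrite -(size_map real_vector) -(@vector.size_basis _ _ _ _ (in_tuple _) tbasis) dimvf.
by rewrite /dim /= muln1.
Qed.

(** Completed to [#|J|] independent edge vectors, [s] gives a square matrix of nonzero determinant,
    hence invertible over the integers. The columns of the inverse are the dual basis. *)
Lemma dual_basis (s : seq E) : free (map real_vector s) ->
  exists v m : 'I_#|J| -> {ffun J -> int},
    [/\ (size s <= #|J|)%N,
        forall i : 'I_#|J|, (i < size s)%N -> v i = edge_vector (nth (None, None) s i),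
        forall i j, dot (m i) (v j) = (i == j)%:R &
        forall x : {ffun J -> int}, (forall j, dot x (v j) = 0) -> x = 0].
Proof.
move=> /complete_edges [t tfree st].
pose e (i : 'I_#|J|) := nth (None, None) (s ++ t) i.
pose tr (o : option J) := omap enum_rank o.
have trE i j : edge_vector (e i) (enum_val j) = edge_vector (tr (e i).1, tr (e i).2) j.
  have E (o : option J) : (o == Some (enum_val j)) = (tr o == Some j).
    case: o => [w|] //=; rewrite !(inj_eq Some_inj).
    by apply/eqP/eqP => [->|<-]; rewrite ?enum_valK ?enum_rankK.
  by rewrite !edge_vectorE !E.
pose A : 'M[int]_#|J| := \matrix_(i, j) edge_vector (e i) (enum_val j).
have Aunit : A \in unitmx.
  have AE : A = \matrix_(i, j) edge_vector (tr (e i).1, tr (e i).2) j.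
    by apply/matrixP => i j; rewrite !mxE trE.
  rewrite unitmxE AE; apply: det_edge_vectors; rewrite -AE.
  rewrite -(intr_eq0 R) -det_map_mx; apply/det0P => -[u /negP u0 uA]; apply: u0.
  have sz : size (map real_vector (s ++ t)) == #|J| by rewrite size_map st.
  have /freeP ufree : free (Tuple sz) by [].
  apply/eqP/rowP => i; rewrite mxE; apply: (ufree (u 0)).
  apply/ffunP => j; have /rowP /(_ (enum_rank j)) := uA; rewrite !mxE => uAj.
  rewrite [RHS]ffunE -[RHS]uAj.
  rewrite sum_ffunE; apply: eq_bigr => k _.
  by rewrite (nth_map (None, None)) ?st // !ffunE !mxE !ffunE enum_rankK.
exists (fun i => edge_vector (e i)), (fun i => [ffun j => invmx A (enum_rank j) i]); split.
- by rewrite -st size_cat leq_addr.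
- by move=> i si; rewrite /e nth_cat si.
- move=> i j; transitivity ((A *m invmx A) j i).
    rewrite mxE /dot (reindex_onto (fun i => enum_val i) enum_rank) => [|k _]; last first.
      exact: enum_rankK.
    apply: eq_big => [k|k _]; first by rewrite enum_valK eqxx.
    by rewrite !mxE mulrC [X in _ * X]ffunE enum_valK.
  by rewrite mulmxV // mxE eq_sym.
move=> x x0; pose c : 'cV[int]_#|J| := \col_k x (enum_val k).
have Ac : A *m c = 0.
  apply/colP => i; rewrite !mxE -[RHS](x0 i) /dot.
  rewrite [RHS](reindex_onto (fun i => enum_val i) enum_rank) => [|k _]; last exact: enum_rankK.
  apply: eq_big => [k|k _]; first by rewrite enum_valK eqxx.
  by rewrite !mxE mulrC.
apply/ffunP => j; rewrite ffunE.
have : c = 0 by rewrite -(mulKmx Aunit c) Ac mulmx0.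
by move/colP/(_ (enum_rank j)); rewrite !mxE enum_rankK.
Qed.

End DualBasis.

(** * Cones of the refinement *)

Section Cones.
Variables (R : realType) (I : finType).
Local Notation ZI := {ffun I -> int}.
Local Notation RI := {ffun I -> R^o}.
Local Notation cone := (@cone R I).
Implicit Types (gs ws : seq ZI) (v w : ZI).

Lemma mem_cone gs k : (k < size gs)%N -> cone gs (toR R gs`_k).
Proof.
move=> ks; exists (fun i => (i == k)%:R) => [i|]; first exact: ler0n.
rewrite (bigD1 (Ordinal ks)) //= eqxx scale1r big1 ?addr0 // => i ik.
by rewrite (_ : (i == k :> nat) = false) ?scale0r //; apply: negbTE.
Qed.

Lemma dual_monoid_cone gs :
  dual_monoid (cone gs) = [set m | forall g, g \in gs -> 0 <= dot m g].
Proof.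
apply/seteqP; split=> m /= mpos.
  move=> g /(nthP 0) [k ks <-]; rewrite -(ler_int R) -dot_toR; apply: mpos.
  exact: mem_cone.
move=> x xc; have := @dot_cone R I gs 0 (toR R m) x xc; rewrite dot0l; apply=> g ggs.
by rewrite dot0l dot_toR ler0z; apply: mpos.
Qed.

Lemma toRMn w k : toR R (w *+ k) = (k%:R : R) *: toR R w.
Proof.
by apply/ffunP => j; rewrite !ffunE ffunMnE rmorphMn /= -mulr_natl.
Qed.

Lemma cone_mulrn gs ws (k : nat -> nat) : size gs = size ws ->
  (forall i, (i < size ws)%N -> (0 < k i)%N /\ gs`_i = ws`_i *+ k i) ->
  cone gs = cone ws.
Proof.
move=> sz gE; apply/seteqP; split=> _ [c c0 ->].
  exists (fun i => c i * (k i)%:R) => [i|]; first by rewrite mulr_ge0 ?ler0n.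
  rewrite sz; apply: eq_bigr => i _; have [_ ->] := gE i (ltn_ord i).
  by rewrite toRMn scalerA.
exists (fun i => c i / (k i)%:R) => [i|]; first by rewrite divr_ge0 ?ler0n.
rewrite sz; apply: eq_bigr => i _; have [ki ->] := gE i (ltn_ord i).
by rewrite toRMn scalerA divfK // pnatr_eq0 -lt0n.
Qed.

Lemma free_nth gs : reflect
  (forall c : 'I_(size gs) -> R, \sum_i c i *: toR R gs`_i = 0 -> forall i, c i = 0)
  (free (map (@toR R I) gs)).
Proof.
apply: (iffP (@freeP _ _ _ (map_tuple (@toR R I) (in_tuple gs)))) => fr c e;
  apply: fr; rewrite -[RHS]e; apply: eq_bigr => i _; by rewrite (nth_map 0).
Qed.

Lemma free_mulrn gs ws (k : nat -> nat) : size gs = size ws ->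
  (forall i, (i < size ws)%N -> (0 < k i)%N /\ gs`_i = ws`_i *+ k i) ->
  free (map (@toR R I) gs) -> free (map (@toR R I) ws).
Proof.
move=> sz gE /free_nth fr; apply/free_nth => c e i.
have /eqP : c i / (k i)%:R = 0.
  have := fr (fun i => c (cast_ord sz i) / (k i)%:R) _ (cast_ord (esym sz) i).
  rewrite cast_ordKV; apply.
  rewrite -[RHS]e (reindex (cast_ord (esym sz))) /=; last first.
    by exists (cast_ord sz) => j _; rewrite ?cast_ordK ?cast_ordKV.
  apply: eq_bigr => j _; rewrite cast_ordKV; have [kj ->] := gE j (ltn_ord j).
  by rewrite toRMn scalerA divfK // pnatr_eq0 -lt0n.
have [ki _] := gE i (ltn_ord i).
by rewrite mulf_eq0 invr_eq0 pnatr_eq0 -[_ == 0%N]negbK -lt0n ki orbF => /eqP.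
Qed.

(** The largest [k] dividing [v] works; it is bounded by any nonzero coordinate. *)
Lemma primitive_multiple v : v != 0 -> exists w k, [/\ (0 < k)%N, v = w *+ k & primitive w].
Proof.
move=> v0; have [j vj] : exists j, v j != 0.
  apply: contrapT => /forallNP none; move/eqP: v0; apply; apply/ffunP => j.
  by rewrite ffunE; apply/eqP/negPn/negP.
have ex : exists k, `[< exists w, v = w *+ k >] by exists 1%N; apply/asboolP; exists v.
have bound k : `[< exists w, v = w *+ k >] -> (k <= `|v j|)%N.
  move=> /asboolP [w vw]; move: vj; rewrite vw ffunMnE => wj.
  rewrite -mulr_natr abszM natz absz_nat leq_pmull // absz_gt0.
  by apply: contraNneq wj => ->; rewrite mul0rn.
case: (ex_maxnP ex bound) => k /asboolP [w vw] kmax; exists w, k.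
have k0 : (0 < k)%N by rewrite lt0n; apply: contraNneq v0 => k0; rewrite vw k0 mulr0n.
split=> // w' k' ww'.
have : (k' * k <= k)%N by apply: kmax; apply/asboolP; exists w'; rewrite mulrnA -ww'.
rewrite -[X in (_ <= X)%N]mul1n leq_pmul2r //.
case: k' ww' => [|[|//]] // w0 _; move/eqP: v0; case.
by rewrite vw w0 mulr0n mul0rn.
Qed.

(** The sum of the coordinates other than the [i]-th is nonnegative on the cone and vanishes there
    only on the ray. *)
Lemma free_face gs i : free (map (@toR R I) gs) -> (i < size gs)%N ->
  is_face (cone [:: gs`_i]) (cone gs).
Proof.
move=> fr si; pose X := map_tuple (@toR R I) (in_tuple gs).
have frX : free X by [].
pose f (x : RI) : R := \sum_(j < size gs | j != i :> nat) coord X j x.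
have f_cone (c : nat -> R) :
    f (\sum_(k < size gs) c k *: toR R gs`_k) = \sum_(j < size gs | j != i :> nat) c j.
  apply: eq_bigr => j _; rewrite -(coord_sum_free (fun k : 'I__ => c k) j frX).
  by congr (coord X j _); apply: eq_bigr => k _; rewrite (nth_map 0).
(* The vector representing the linear form [f], given by its values on the standard basis. *)
pose m : RI := [ffun w => f [ffun j => (j == w)%:R]].
have dot_m x : (dot m x : R) = f x.
  have {2}-> : x = \sum_w (x w : R) *: ([ffun j => (j == w)%:R] : RI).
    apply/ffunP => j; rewrite sum_ffunE (bigD1 j) //= big1 ?addr0 => [|w wj].
      by rewrite !ffunE eqxx /GRing.scale /= mulr1.
    by rewrite !ffunE eq_sym (negbTE wj) /GRing.scale /= mulr0.
  rewrite /f; under eq_bigr do rewrite linear_sum.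
  rewrite exchange_big; apply: eq_bigr => w _.
  rewrite ffunE mulrC /f mulr_sumr; apply: eq_bigr => j _.
  by rewrite linearZ.
exists m => [_ [c c0 ->]|]; first by rewrite dot_m f_cone sumr_ge0.
apply/seteqP; split=> [_ [c c0 ->]|_ [[c c0 ->]]].
  rewrite big_ord1 /=.
  have E : c 0%N *: toR R gs`_i =
      \sum_(k < size gs) (if k == i :> nat then c 0%N else 0) *: toR R gs`_k.
    rewrite (bigD1 (Ordinal si)) //= eqxx big1 ?addr0 // => k ki.
    by rewrite ifF ?scale0r //; apply: negbTE.
  split; first by rewrite E; exists (fun k => if k == i then c 0%N else 0) => // k; case: ifP.
  rewrite dot_m E (f_cone (fun k => if k == i then c 0%N else 0)) big1 // => j /negbTE ->//.
rewrite dot_m f_cone => /eqP; rewrite psumr_eq0 // => /allP cz.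
exists (fun=> c i) => //; rewrite big_ord1 /= (bigD1 (Ordinal si)) //= big1 ?addr0 // => k ki.
have := cz k; rewrite mem_index_enum => /(_ isT) /implyP /(_ ki) /eqP ->.
by rewrite scale0r.
Qed.

End Cones.

(** * Rays and cones of a crepant refinement *)

Section HibiFan.
Variables (R : realType) (d : Order.disp_t) (P : finPOrderType d).
Local Notation cone := (@cone R P).

Lemma hasse_primitive (e : option P * option P) : hasse e -> primitive (edge_vector e).
Proof.
move=> /and3P [e0 elt _] w k ew.
have [j ej] : exists j, `|edge_vector e j|%N = 1%N.
  case: e e0 elt {ew} => [[u|] [v|]] //= _ elt.
  - by exists v; rewrite edge_vectorE /= eqxx (inj_eq Some_inj) lt_eqF.
  - by exists u; rewrite edge_vectorE /= eqxx.
  - by exists v; rewrite edge_vectorE /= eqxx.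
move: ej; rewrite ew ffunMnE -mulr_natr abszM natz absz_nat => /eqP.
by rewrite muln_eq1 => /andP [_ /eqP].
Qed.

Lemma crepant_ray_edge (SigmaHat : set (set {ffun P -> R^o})) v :
  refines SigmaHat (hibi_fan R P) -> crepant SigmaHat (hibi_fan R P) ->
  ray_generator SigmaHat v -> exists2 e, hasse e & v = edge_vector e.
Proof.
move=> [ref _] [k [m [k0 down up]]] vray; have [_ Sv] := vray.
have [sigma Ssigma vsigma] := ref _ Sv.
have {}vsigma : sigma (toR R v) by apply/vsigma/(mem_cone R (gs := [:: v]) (k := 0)).
have dotv : dot (m sigma) v = k.
  by have := up _ _ Ssigma vray vsigma; rewrite mulrN1 => /oppr_inj.
have [s /allP shasse sE] := hibi_coneP Ssigma.
have dote e : e \in s -> dot (m sigma) (edge_vector e) = k.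
  move=> es; apply: oppr_inj; rewrite -[RHS]mulrN1; apply: down => //.
    by split; [exact/hasse_primitive/shasse|exact/hibi_ray/shasse].
  have es' : edge_vector e \in map (@edge_vector _) s by apply: map_f.
  by rewrite sE -(nth_index 0 es'); apply: mem_cone; rewrite index_mem.
move: vsigma; rewrite sE => -[c c0 ve].
have vsum : toR R v = \sum_(i < size s) (c i : R) *: toR R (edge_vector (nth (None, None) s i)).
  by rewrite ve size_map; apply: eq_bigr => i _; rewrite (nth_map (None, None)).
have [||||i vi] := @average_edges R P (size s) c (fun i => nth (None, None) s i) v.
- by move=> i; apply: c0.
(* The form [m sigma] takes the same nonzero value [k] on [v] and on each generator, so the
   coefficients sum to 1. *)
- have : (dot (toR R (m sigma)) (toR R v) : R) = k%:R by rewrite dot_toR dotv.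
  rewrite vsum dotC dot_suml => e.
  have k1 : (k%:R : R) != 0 by rewrite pnatr_eq0 -lt0n.
  apply: (mulIf k1); rewrite mul1r -[RHS]e mulr_suml; apply: eq_bigr => i _.
  by rewrite dotZl dotC dot_toR dote // mem_nth.
- move=> j; have /ffunP /(_ j) := vsum; rewrite sum_ffunE ffunE => ->.
  by apply: eq_bigr => i _; rewrite !ffunE.
- by apply: contraTneq k0 => v0; move: dotv; rewrite v0 dotC dot0l => -[<-].
by exists (nth (None, None) s i) => //; apply/shasse/mem_nth.
Qed.

(** Each generator of a simplicial cone spans a face, so its primitive direction is a ray generator
    of the refinement, hence a Hasse edge vector. The given generators need not be primitive, whence
    the multiples [(ek i).2]. *)
Lemma Qfactorialization_cone (SigmaHat : set (set {ffun P -> R^o})) tau :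
  crepant_Qfactorialization SigmaHat (hibi_fan R P) -> SigmaHat tau ->
  exists s : seq (option P * option P), [/\ all (@hasse d P) s,
    free (map (fun e => toR R (edge_vector e)) s) & tau = cone (map (@edge_vector P) s)].
Proof.
move=> [fan ref simp crep] Stau; have [gs gfree tauE] := simp _ Stau.
have /choice [ek ekP] (i : nat) : exists ek : (option P * option P) * nat, (i < size gs)%N ->
    [/\ hasse ek.1, (0 < ek.2)%N & gs`_i = edge_vector ek.1 *+ ek.2].
  have [si|_] := ltnP i (size gs); last by exists ((None, None), 0%N).
  have g0 : gs`_i != 0.
    have : toR R gs`_i != 0 by apply: (free_not0 gfree); apply/map_f/mem_nth.
    apply: contraNneq => ->; apply/eqP/ffunP => j; by rewrite !ffunE.
  have [w [k [k0 gw wprim]]] := primitive_multiple g0.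
  have [e he we] : exists2 e, hasse e & w = edge_vector e.
    apply: crepant_ray_edge ref crep _; split=> //.
    rewrite -(@cone_mulrn R P [:: gs`_i] [:: w] (fun=> k)) //; last by case.
    apply: (fan_face fan Stau); rewrite tauE; exact: free_face.
  by exists (e, k) => _; rewrite -we.
pose s := mkseq (fun i => (ek i).1) (size gs).
have sz : size gs = size (map (@edge_vector P) s) by rewrite size_map size_mkseq.
have gE i : (i < size (map (@edge_vector P) s))%N -> (0 < (ek i).2)%N /\
    gs`_i = (map (@edge_vector P) s)`_i *+ (ek i).2.
  rewrite -sz => si; have [_ k0 ge] := ekP i si; split=> //.
  by rewrite (nth_map (None, None)) ?size_mkseq // nth_mkseq.
exists s; split.
- apply/(all_nthP (None, None)) => i; rewrite size_mkseq => si.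
  by rewrite nth_mkseq //; case: (ekP i si).
- by rewrite (map_comp (@toR R P)); apply: free_mulrn sz gE gfree.
- by rewrite tauE; apply: cone_mulrn sz gE.
Qed.

End HibiFan.

(** * Nonsingularity and smallness *)

Lemma chart_ringE (R : realType) (I : finType) (sigma : set {ffun I -> R^o}) :
  chart_ring sigma = monoid_algebra (R := R) (dual_monoid sigma).
Proof. by []. Qed.

Theorem proposition2p6 (R : realType) (d : Order.disp_t) (P : finPOrderType d)
    (SigmaHat : set (set {ffun P -> R^o})) :
  pure P ->
  crepant_Qfactorialization SigmaHat (hibi_fan R P) ->
  nonsingular (toric_variety SigmaHat) /\
  small_morphism (toric_variety SigmaHat) (toric_variety (hibi_fan R P)).
Proof.
move=> _ SH.
(* Each cone is spanned by the first [size s] vectors of a lattice basis [v] with dual basis [m]. *)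
have chart tau : SigmaHat tau -> exists s (v m : 'I_#|P| -> {ffun P -> int}),
    [/\ forall i j, dot (m i) (v j) = (i == j)%:R,
        forall x, (forall j, dot x (v j) = 0) -> x = 0,
        forall i : 'I_#|P|, (i < size s)%N -> 
          hasse (nth (None, None) s i) /\ v i = edge_vector (nth (None, None) s i) &
        dual_monoid tau = dual_orthant v (fun i => i < size s)%N].
  move=> /(Qfactorialization_cone SH) [s [/allP shasse sfree ->]].
  have [v [m [ssz vE dual spans]]] := dual_basis sfree.
  exists s, v, m; split=> //.
    by move=> i si; split; [exact/shasse/mem_nth|exact: vE].
  rewrite dual_monoid_cone; apply/seteqP; split=> x /= xpos.
    by move=> i si; rewrite vE //; apply/xpos/map_f/mem_nth.
  move=> _ /mapP [e es ->]; rewrite -(nth_index (None, None) es).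
  have si : (index e s < size s)%N by rewrite index_mem.
  by have := xpos (Ordinal (leq_trans si ssz)) si; rewrite vE.
split=> [O [tau [p [Stau pp ->]]]|O [[tau [p [Stau pp OE]]] notY]].
  have [s [v [m [dual spans _ tauE]]]] := chart _ Stau.
  by move: pp; rewrite chart_ringE tauE; apply: chart_regular dual spans _ _.
have [s [v [m [dual spans vE tauE]]]] := chart _ Stau.
move: pp OE; rewrite chart_ringE tauE => pp OE.
set a : pred 'I_#|P| := fun i => (i < size s)%N in tauE pp OE.
(* Two variables vanishing at the point give dimension at least two; otherwise at most one vanishes,
   and the point is shown not to be exceptional. *)
have [[i [j [ij Pi Pj]]]|none] := pselect (exists i j,
    [/\ i != j, p (character R (m i)) & p (character R (m j))]).
  by rewrite OE; apply: (chart_krull_dim dual spans pp ij).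
have [p' pp' OE'] := chart_specialize dual pp.
set b := (fun j => a j && _) in pp' OE'.
(* If the smaller chart is also a chart of the Hibi variety, the local ring [O] belongs to both
   varieties and dominates itself, so the point is not exceptional. *)
suff [rho Srho rhoE] : exists2 rho, hibi_fan R P rho & dual_orthant v b = dual_monoid rho.
  case: (notY O); [|split=> //|by []]; last first.
    by apply/seteqP; split=> f; [move=> mf; split=> //; case: mf|case].
  by exists rho, p'; rewrite chart_ringE -rhoE OE' -OE.
(* The smaller chart is that of the ray of [v i] if one variable vanishes, and of the zero cone if
   none does. *)
have [/existsP [i bi]|/existsPn nob] := boolP [exists i, b i].
  have /andP [ai /asboolP Pi] := bi.
  have [he vi] := vE i ai.
  exists (@cone R P [:: v i]); first by rewrite vi; apply: hibi_ray.
  rewrite dual_monoid_cone; apply/seteqP; split=> x /=.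
    by move=> /(_ i bi) xi g; rewrite inE => /eqP ->.
  move=> xpos j /andP [aj /asboolP Pj]; have [->|ij] := eqVneq j i.
    by apply: xpos; rewrite mem_head.
  by case: none; exists j, i.
exists (@cone R P [::]); first exact: hibi_fan0.
rewrite dual_monoid_cone; apply/seteqP; split=> x //= _ j bj.
by have := nob j; rewrite bj.
Qed.
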